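(* Let $\tau_0\subseteq[0,1]$ be a time interval and let $2<p\le4$. Then there is a constant $c>0$ such that for all $N,M\ge1$ with $N\ge M$, all $\mathcal{C}_1\in\mathscr{C}_N$, all $\mathcal{C}_2,\mathcal{C}_3\in\mathscr{C}_M$, and all $\phi_1,\phi_2,\phi_3\in L^2(\mathbb{T}^2)$, $$\Big\|\prod_{j=1}^3P_{\mathcal{C}_j}e^{it\Delta}\phi_j\Big\|_{L^p(\tau_0,L^2(\mathbb{T}^2))}\le c\,M^{2-\frac2p}\prod_{j=1}^3\|P_{\mathcal{C}_j}\phi_j\|_{L^2(\mathbb{T}^2)}.$$
   Context: $\mathbb{T}^2=\mathbb{R}^2/\mathbb{Z}^2$, $\widehat f(n)=\int_{[0,1]^2}e^{-2\pi ix\cdot n}f(x)\,dx$ for $n\in\mathbb{Z}^2$. Fix $C>1$ and $\alpha_1,\alpha_2\in(\frac1C,C)$, and put $Q(n)=\alpha_1n_1^2+\alpha_2n_2^2$. The linear Schrödinger evolution is $(e^{it\Delta}f)(x)=\sum_{n\in\mathbb{Z}^2}\widehat f(n)e^{2\pi i(n\cdot x+Q(n)t)}$. For $\mathcal{S}\subseteq\mathbb{Z}^2$, $P_{\mathcal{S}}$ is the Fourier multiplier with symbol the characteristic function of $\mathcal{S}$. For $N\ge1$, $\mathscr{C}_N$ is the collection of all $\mathcal{C}\subseteq\mathbb{Z}^2$ for which there exist $z\in\mathbb{Z}^2$ and an orthogonal $2\times2$ matrix $O$ with $O\mathcal{C}+z\subseteq[-N,N]^2$. The norm of $L^p(\tau_0,L^2(\mathbb{T}^2))$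 is $\big(\int_{\tau_0}\|u(t)\|_{L^2(\mathbb{T}^2)}^p\,dt\big)^{1/p}$. The constant $c$ may depend on $C$, $p$ and $\tau_0$, but not on $N,M$, the $\mathcal{C}_j$ or the $\phi_j$. *)

(* Defs.v *)
From HB Require Import structures.
From mathcomp Require Import all_boot all_order all_algebra finmap.
From mathcomp Require Import all_classical all_reals all_analysis.
From mathcomp Require Import summability.
From mathcomp Require Export complex.
Set Implicit Arguments.
Unset Strict Implicit.
Unset Printing Implicit Defensive.
Import Order.TTheory GRing.Theory Num.Theory.
Import numFieldNormedType.Exports.
Local Open Scope classical_set_scope.
Local Open Scope ring_scope.

(** Functions on the torus R^2/Z^2 are Z^2-periodic functions on [R * R];
    integrals over the torus are integrals over the unit square. *)

Section Torus.
Variable R : realType.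

Definition Z2 : Type := (int * int)%type.

Definition plane_measure :
    {measure set (measurableTypeR R * measurableTypeR R) -> \bar R} :=
  (@lebesgue_measure R \x @lebesgue_measure R)%E.

Definition unit_square : set (R * R) := `[0, 1] `*` `[0, 1].

Definition cabs (z : R[i]) : R := complex.Re `|z|.

(** e^{i theta} *)
Definition cis (theta : R) : R[i] := Complex (cos theta) (sin theta).

Definition dotZ (n : Z2) (x : R * R) : R := n.1%:~R * x.1 + n.2%:~R * x.2.

Definition Z2periodic (f : R * R -> R[i]) : Prop :=
  forall (x : R * R) (k : Z2), f (x.1 + k.1%:~R, x.2 + k.2%:~R) = f x.

Definition L2norm (f : R * R -> R[i]) : \bar R :=
  ((\int[plane_measure]_(x in unit_square) (cabs (f x) ^+ 2)%:E)
     `^ (2^-1))%E.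

Definition L2 : set (R * R -> R[i]) := [set f |
  [/\ Z2periodic f,
      measurable_fun setT (fun x => complex.Re (f x)),
      measurable_fun setT (fun x => complex.Im (f x)) &
      (L2norm f < +oo)%E]].

Definition Cintegral (f : R * R -> R[i]) : R[i] :=
  Complex (\int[plane_measure]_(x in unit_square) complex.Re (f x))
          (\int[plane_measure]_(x in unit_square) complex.Im (f x)).

Definition fourier (f : R * R -> R[i]) (n : Z2) : R[i] :=
  Cintegral (fun x => cis (- (2 * pi * dotZ n x)) * f x).

(** [L2sum g] is a representative of the sum of the [g n] over all [n] in Z^2,
    in the sense of unconditional convergence in L^2 of the torus. It is unique
    only up to a null set, and is the zero function when the sum diverges. *)
Definition is_L2sum (g : Z2 -> R * R -> R[i]) (u : R * R -> R[i]) : Prop :=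
  L2 u /\
  (fun A : {fset Z2} => L2norm (fun x => u x - \sum_(n <- A) g n x))
    @ totally --> 0%E.

Definition L2sum (g : Z2 -> R * R -> R[i]) : R * R -> R[i] :=
  xget (fun=> 0) [set u | is_L2sum g u].

Definition Qform (a1 a2 : R) (n : Z2) : R :=
  a1 * n.1%:~R ^+ 2 + a2 * n.2%:~R ^+ 2.

(** e^{it Delta} for the symbol [Qform a1 a2] *)
Definition schrodinger (a1 a2 t : R) (f : R * R -> R[i]) : R * R -> R[i] :=
  L2sum (fun n x =>
    fourier f n * cis (2 * pi * (dotZ n x + Qform a1 a2 n * t))).

Definition multiplier (m : Z2 -> R[i]) (f : R * R -> R[i]) :
    R * R -> R[i] :=
  L2sum (fun n x => m n * fourier f n * cis (2 * pi * dotZ n x)).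

Definition fourier_proj (S : set Z2) : (R * R -> R[i]) -> R * R -> R[i] :=
  multiplier (fun n => Complex (\1_S n) 0).

Definition colZ (n : Z2) : 'cV[R]_2 :=
  \col_(i < 2) (if i == 0 then n.1 else n.2)%:~R.

(** The collection of subsets of Z^2 that some rigid motion (an orthogonal
    matrix followed by an integer translation) maps into [-N, N]^2. *)
Definition rotated_boxes (N : R) : set (set Z2) := [set S |
  exists (z : Z2) (O : 'M[R]_2),
    O *m O^T = 1%:M /\
    forall n, S n -> forall i : 'I_2, - N <= (O *m colZ n + colZ z) i 0 <= N].

Definition LpL2norm (p : R) (tau : set R) (u : R -> R * R -> R[i]) : \bar R :=
  ((\int[@lebesgue_measure R]_(t in tau) (L2norm (u t) `^ p)) `^ (p^-1))%E.

End Torus.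

(* Main.v *)
(** By Hoelder in time, the left-hand side is at most the product of the
    [L^oo L^2] norm of the first factor, which is controlled by Plancherel, and
    of the [L^(2p) L^oo] norms of the other two.  It thus suffices to bound each
    of these by [M^(1-1/p)] times the [L^2] norm.  A rotated box of size [M] lies
    in a translate of [[-L, L]^2] with [L] about [3M], whatever the rotation.
    Time is cut into [L^2] bins, and one near-maximal point [(x_j, t_j)] is
    chosen in each bin.  By duality the resulting discrete estimate concerns the
    kernel at [(x_i - x_j, t_i - t_j)]; smoothed by triangle weights, it is a
    product of two one-dimensional Weyl sums, and Weyl differencing bounds the
    square of each uniformly in space by [L^3] times the number of [0 <= h < L]
    such that [h theta] is within [1/(3L)] of an integer, where [theta] is
    [2 a (t_i - t_j)].  Having more than [mu] such returns forces [theta] close to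
    a fraction with denominator at most [L/mu], which happens for at most about
    [(L/mu)^2] of the times [t_j].  Summing over dyadic [mu], the [p]-th moments
    of the returns over [j] are [O(L^p)] because [p > 2], and a Schur test closes
    the argument. *)
Require Import Defs.
From HB Require Import structures.
From mathcomp Require Import all_boot all_order all_algebra.
From mathcomp Require Import all_classical all_reals all_analysis.
From mathcomp Require Import ring lra zify finmap measurable_realfun summability.
Import Order.TTheory GRing.Theory Num.Theory.
Import numFieldNormedType.Exports.
Local Open Scope ring_scope.

(** There is no logarithm to spare, and this shapes the proof at two points. A sharp frequency
    cutoff would leave linear sums decaying like the inverse distance of the frequency to the
    integers, and summing this over the cells costs [log L]; the second differences of the triangle
    weights give the inverse square, which is summable. In the moments of the returns all dyadic
    scales would count equally at [p = 2], whereas for [p > 2] the top scale dominates. Up to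
    constants, the row sums of the kernel are then no larger than their diagonal term, where all [L]
    lags are returns. Weyl differencing is uniform in the linear coefficient, and the points [x_j]
    and the centre of the box enter the kernel only through constant and linear coefficients. Hence
    the points may be placed anywhere, one per time bin, and only differences of times matter. The
    product of the two Weyl sums is bounded by half the sum of their squares, so [a1] and [a2] are
    treated one at a time and no arithmetic relation between them enters. *)

Section ComplexModulus.
Context {R : realType}.
Implicit Types (z w : R[i]) (a b : R).

Lemma cabsE z : cabs z = Num.sqrt (complex.Re z ^+ 2 + complex.Im z ^+ 2).
Proof. by rewrite /cabs normc_def. Qed.

Lemma sqr_cabs z : cabs z ^+ 2 = complex.Re z ^+ 2 + complex.Im z ^+ 2.
Proof. by rewrite cabsE sqr_sqrtr// addr_ge0 ?sqr_ge0. Qed.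

Lemma cabs_ge0 z : 0 <= cabs z. Proof. by rewrite cabsE sqrtr_ge0. Qed.

Lemma cabsM z w : cabs (z * w) = cabs z * cabs w.
Proof. by rewrite /cabs normrM !normc_def /= mulr0 subr0. Qed.

Lemma cabsD z w : cabs (z + w) <= cabs z + cabs w.
Proof.
have := ler_normD z w; rewrite !normc_def -raddfD /= lecR.
by rewrite !cabsE.
Qed.

Lemma cabs0 : cabs (0 : R[i]) = 0.
Proof. by rewrite /cabs normr0. Qed.

Lemma cabs_eq0 z : (cabs z == 0) = (z == 0).
Proof. by rewrite -(normr_eq0 z) normc_def cabsE eq_complex /= eqxx andbT. Qed.

Lemma cabs_real a : cabs (Complex a 0) = `|a|.
Proof. by rewrite cabsE /= expr0n addr0 sqrtr_sqr. Qed.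

Lemma cabsJ z : cabs (conjc z) = cabs z.
Proof. by case: z => x y; rewrite !cabsE /= sqrrN. Qed.

Lemma cabsN z : cabs (- z) = cabs z.
Proof. by rewrite /cabs normrN. Qed.

Lemma cabs_cis a : cabs (cis a) = 1.
Proof. by rewrite cabsE /= cos2Dsin2 sqrtr1. Qed.

Lemma cabs_sum (I : Type) (r : seq I) (P : pred I) (F : I -> R[i]) :
  cabs (\sum_(i <- r | P i) F i) <= \sum_(i <- r | P i) cabs (F i).
Proof.
elim/big_rec2 : _ => [|i x y _ h]; first by rewrite cabs0.
by rewrite (le_trans (cabsD _ _))// lerD2l.
Qed.

Lemma mulcJ z : z * conjc z = Complex (cabs z ^+ 2) 0.
Proof.
rewrite sqr_cabs; case: z => x y; apply/eqP; rewrite eq_complex /=.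
by apply/andP; split; apply/eqP; ring.
Qed.

Lemma cis0 : cis 0 = 1 :> R[i].
Proof. by rewrite /cis cos0 sin0. Qed.

Lemma cisD a b : cis (a + b) = cis a * cis b.
Proof.
apply/eqP; rewrite eq_complex /= sinD cosD; apply/andP; split; apply/eqP => //.
by rewrite addrC [X in _ + X]mulrC addrC mulrC addrC.
Qed.

Lemma cisN a : cis (- a) = conjc (cis a).
Proof. by rewrite /cis cosN sinN. Qed.

Lemma cis2pi (n : int) : cis (2 * pi * n%:~R) = 1 :> R[i].
Proof.
have nat_case (m : nat) : cis (2 * pi * m%:R) = 1 :> R[i].
  elim: m => [|m IH]; first by rewrite mulr0 cis0.
  rewrite (_ : m.+1%:R = m%:R + 1 :> R); last by rewrite natr1.
  rewrite mulrDr cisD IH mul1r mulr1 /cis.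
  by rewrite mulr_natl cos2pi sin2pi.
case: n => m; first exact: nat_case.
by rewrite NegzE mulrNz mulrN cisN nat_case conjc1.
Qed.

End ComplexModulus.

(** * Return times of a rotation of the circle and their structure *)

Section Returns.
Context {R : realType}.
Implicit Types (y th d : R) (L : nat).

Definition near_int y d : Prop := exists m : int, `|y - m%:~R| <= d.

Definition returns L th : {set 'I_L} :=
  [set i : 'I_L | `[< near_int (i%:R * th) (3 * L%:R)^-1 >]].

Definition fpart y : R := y - (Num.floor y)%:~R.

Lemma fpart_itv y : 0 <= fpart y < 1.
Proof.
have /andP[h1 h2] := floor_itv y.
by rewrite /fpart subr_ge0 h1 /= ltrBlDl -[1]/(1%:~R) -intrD.
Qed.

(* The index of the interval of length [1/(3L)] of the circle containing [y]. *)
Definition cell L y : nat := Num.truncn (3 * L%:R * fpart y).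

Lemma cell_itv L y :
  (cell L y)%:R <= 3 * L%:R * fpart y < (cell L y).+1%:R.
Proof.
apply: truncn_itv; rewrite !mulr_ge0//.
by have /andP[] := fpart_itv y.
Qed.

Lemma cell_lt L y : (0 < L)%N -> (cell L y < 3 * L)%N.
Proof.
move=> L0; have /andP[h1 _] := cell_itv L y; have /andP[_ h2] := fpart_itv y.
rewrite -(ltr_nat R) (le_lt_trans h1)// natrM gtr_pMr//.
by rewrite mulr_gt0// ltr0n.
Qed.

(* The difference of two times spent in the same cell is a return. *)
Lemma card_cell_le_returns L y th (j : nat) : (0 < L)%N ->
  (#|[set i : 'I_L | cell L (y + i%:R * th)%R == j]| <= #|returns L th|)%N.
Proof.
move=> L0; set A := [set i | _].
have [->|[i1 i1A]] := set_0Vmem A; first by rewrite cards0.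
case: (arg_minnP (fun i : 'I_L => nat_of_ord i) i1A) => i0 i0A' i0min.
have i0A : i0 \in A by [].
have L0' : (0 : R) < 3 * L%:R by rewrite mulr_gt0// ltr0n.
pose f (i : 'I_L) : 'I_L := Ordinal (leq_ltn_trans (leq_subr i0 i) (ltn_ord i)).
have finj : {in A &, injective f}.
  move=> i i' iA i'A /(congr1 val) /= e; apply: val_inj => /=.
  by have := i0min _ iA; have := i0min _ i'A; lia.
rewrite -(card_in_imset finj) subset_leq_card//.
apply/fintype.subsetP => _ /imsetP[i iA ->]; rewrite inE; apply/asboolP.
have i0i := i0min _ iA.
move: iA i0A; rewrite !inE => /eqP ci /eqP ci0.
exists (Num.floor (y + i%:R * th) - Num.floor (y + i0%:R * th)).
rewrite /= natrB// rmorphB /=.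
have := cell_itv L (y + i%:R * th); have := cell_itv L (y + i0%:R * th).
rewrite ci ci0 /fpart -[j.+1]addn1 natrD.
set u := _ - _%:~R; set v := _ - _%:~R => /andP[h1 h2] /andP[h3 h4].
have -> : (i%:R - i0%:R) * th -
   ((Num.floor (y + i%:R * th))%:~R - (Num.floor (y + i0%:R * th))%:~R) = v - u.
  by rewrite /u /v; ring.
rewrite ler_norml.
have E : (3 * L%:R)^-1 * (3 * L%:R) = 1 :> R by rewrite mulVf// gt_eqF.
by apply/andP; split; rewrite -(ler_pM2r L0'); rewrite ?mulNr E; lra.
Qed.

(** A frequency in cell [j] is at distance at least [minn j (3 * L - 1 - j)] from the integers, in
    units of [1/(3L)]: this is the profile of an inverse-square decay. The added 1 keeps it finite
    in the two cells adjacent to an integer. *)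
Definition cell_weight L (j : nat) : R :=
  ((1 + (minn j (3 * L - 1 - j))%:R) ^+ 2)^-1.

Lemma sum_inv_sqr n : \sum_(i < n) (((1 + i%:R) ^+ 2)^-1 : R) <= 2.
Proof.
suff : \sum_(i < n) (((1 + i%:R) ^+ 2)^-1 : R) <= 2 - n%:R^-1.
  by move/le_trans; apply; rewrite gerBl.
elim: n => [|n IH]; first by rewrite big_ord0 invr0 subr0.
rewrite big_ord_recr /=.
case: n IH => [|n] IH; first by rewrite big_ord0 addr0 expr1n invr1; lra.
apply: (le_trans (lerD IH (lexx _))).
rewrite -[n.+2]addn1 -[n.+1]addn1 !natrD; set x : R := n%:R.
have x0 : 0 <= x by exact: ler0n.
have -> : (1 + (x + 1)) ^+ 2 = (x + 2) ^+ 2 by ring.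
have h : (x + 1)^-1 - (x + 1 + 1)^-1 - ((x + 2) ^+ 2)^-1
    = (x + 1)^-1 * ((x + 2) ^+ 2)^-1.
  by field; apply/andP; split; rewrite gt_eqF//; lra.
have : 0 <= (x + 1)^-1 * ((x + 2) ^+ 2)^-1.
  by rewrite mulr_ge0// invr_ge0 ?exprn_ge0//; lra.
rewrite -h; lra.
Qed.

Lemma sum_cell_weight L : \sum_(j < 3 * L) cell_weight L j <= 4.
Proof.
apply: (@le_trans _ _ (\sum_(j < 3 * L) (((1 + j%:R) ^+ 2)^-1
    + ((1 + (3 * L - 1 - j)%:R) ^+ 2)^-1))).
  apply: ler_sum => j _; rewrite /cell_weight.
  by rewrite /minn; case: ifP => _; rewrite ?lerDl ?lerDr invr_ge0 exprn_ge0//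
    addr_ge0.
rewrite big_split /= [X in _ + X](reindex_inj rev_ord_inj) /=.
have -> : (4 : R) = 2 + 2 by ring.
apply: lerD; first exact: sum_inv_sqr.
apply: le_trans (sum_inv_sqr (3 * L)); rewrite le_eqVlt; apply/orP; left.
apply/eqP; apply: eq_bigr => i _; congr ((_ + _%:R) ^+ 2)^-1.
by have := ltn_ord i; lia.
Qed.

(** No cell holds more than [#|returns L th|] of the [L] points, and the weights of all cells add up
    to at most 4, wherever the orbit starts. *)
Lemma sum_cell_weight_orbit L y th : (0 < L)%N ->
  \sum_(i < L) cell_weight L (cell L (y + i%:R * th)) <= 4 * #|returns L th|%:R.
Proof.
move=> L0.
pose c (i : 'I_L) : 'I_(3 * L) := Ordinal (cell_lt L (y + i%:R * th) L0).
rewrite (partition_big c xpredT) //=.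
apply: (@le_trans _ _ (\sum_(j < 3 * L) cell_weight L j * #|returns L th|%:R)).
  apply: ler_sum => j _.
  rewrite (eq_bigr (fun=> cell_weight L j)); last first.
    by move=> i /eqP <-.
  rewrite sumr_const -[leLHS]mulr_natr ler_wpM2l//.
    by rewrite invr_ge0 exprn_ge0// addr_ge0.
  rewrite ler_nat; apply: leq_trans (card_cell_le_returns L y th j L0).
  apply: subset_leq_card; apply/fintype.subsetP => i; rewrite inE unfold_in => /eqP e.
  by apply/eqP; rewrite -e.
by rewrite -mulr_suml ler_wpM2r// sum_cell_weight.
Qed.

Lemma int_eq0_small (m : int) : `|m%:~R : R| < 1 -> m = 0.
Proof.
rewrite ltr_norml => /andP[h1 h2].
have {}h1 : -1 < m by rewrite -(ltr_int R) rmorphN.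
have {}h2 : m < 1 by rewrite -(ltr_int R).
lia.
Qed.

(* Let [r] be least with [r th] within [2/(3L)] of an integer, and [g] the
   largest return: the integer determinant of the two approximations is less than
   1 in absolute value, so they are proportional and the error at [r] is [r / g]
   times the error at [g]. *)
Lemma returns_structure L th (nu : nat) : (0 < nu)%N ->
  #|returns L th| = nu.+1 ->
  exists r a : int, [/\ (1 <= r)%R, (r * nu%:Z <= L%:Z)%R &
    `|r%:~R * th - a%:~R| <= (3 * L%:R * nu%:R)^-1].
Proof.
move=> nu0 cardE.
have L0 : (0 < L)%N.
  by have := max_card (mem (returns L th)); rewrite cardE card_ord; lia.
have L0' : (0 : R) < 3 * L%:R by rewrite mulr_gt0// ltr0n.
pose d : R := (3 * L%:R)^-1.
have d0 : 0 < d by rewrite invr_gt0.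
pose o := Ordinal L0.
have oR : o \in returns L th.
  by rewrite inE; apply/asboolP; exists 0; rewrite /= mul0r subrr normr0 ltW.
case: (arg_maxnP (fun i : 'I_L => nat_of_ord i) oR) => g gR' gmax.
have gR : g \in returns L th by [].
(* The tolerance is twice that of a return, so that the difference of two distinct returns also
   satisfies [P]. *)
pose P n := (0 < n)%N && `[< near_int (n%:R * th) (2 * d) >].
have retP i : i \in returns L th -> near_int (i%:R * th) d.
  by rewrite inE => /asboolP.
have g0 : (0 < g)%N.
  rewrite lt0n; apply/negP => /eqP g0.
  have : (#|returns L th| <= #|[set o]|)%N.
    apply: subset_leq_card; apply/fintype.subsetP => i iR; rewrite inE.
    by apply/eqP/val_inj => /=; have := gmax _ iR; lia.
  by rewrite cards1 cardE; lia.
have Pg : P g.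
  rewrite /P g0 /=; apply/asboolP; have [m hm] := retP _ gR.
  by exists m; apply: (le_trans hm); lra.
have exP : exists n, P n by exists g.
case: (ex_minnP exP) => r /andP[r0 /asboolP[a ha]] rmin.
have rg : (r <= g)%N := rmin _ Pg.
(* By minimality of [r], distinct returns are at least [r] apart and so have distinct quotients by
   [r]; the [nu + 1] returns need [nu + 1] quotients between 0 and [g %/ r]. *)
have quo : (nu <= g %/ r)%N.
  pose f (i : 'I_L) : 'I_(g %/ r).+1 := inord (i %/ r).
  have fE i : i \in returns L th -> f i = (i %/ r)%N :> nat.
    by move=> iR; rewrite inordK// ltnS leq_div2r//; exact: gmax.
  have finj : {in returns L th &, injective f}.
    have step (i i' : 'I_L) : i \in returns L th -> i' \in returns L th ->
        (i < i')%N -> (i %/ r < i' %/ r)%N.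
      move=> iR i'R ii'; have [m hm] := retP _ iR; have [m' hm'] := retP _ i'R.
      have : P (i' - i)%N.
        rewrite /P subn_gt0 ii' /=; apply/asboolP; exists (m' - m).
        rewrite natrB 1?ltnW// rmorphB /=.
        have -> : (i'%:R - i%:R) * th - (m'%:~R - m%:~R) =
          (i'%:R * th - m'%:~R) - (i%:R * th - m%:~R) by ring.
        by apply: (le_trans (ler_normB _ _)); lra.
      move/rmin => h.
      have -> : ((i %/ r).+1 = (i + r) %/ r)%N.
        by rewrite divnDr ?dvdnn// divnn r0 addn1.
      by rewrite leq_div2r// -leq_subRL// ltnW.
    move=> i i' iR i'R /(congr1 val) /=; rewrite !fE// => e.
    apply: ord_inj; case: (ltngtP i i') => // h.
      by have := step _ _ iR i'R h; rewrite e ltnn.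
    by have := step _ _ i'R iR h; rewrite e ltnn.
  have : (#|returns L th| <= #|{: 'I_(g %/ r).+1}|)%N.
    by rewrite -(card_in_imset finj) max_card.
  by rewrite cardE card_ord.
have nur : (nu * r <= g)%N by rewrite (leq_trans (leq_mul quo (leqnn r)))// leq_divM.
have [b hb] := retP _ gR.
have gL : (g < L)%N by [].
have g0' : (0 : R) < g%:R by rewrite ltr0n.
have r0' : (0 : R) < r%:R by rewrite ltr0n.
have nu0' : (0 : R) < nu%:R by rewrite ltr0n.
have gLR : (g%:R : R) + 1 <= L%:R by rewrite natr1 ler_nat.
have rgR : (r%:R : R) <= g%:R by rewrite ler_nat.
have dL : d * (3 * L%:R) = 1 by rewrite mulVf// gt_eqF.
set rho := r%:R * th - a%:~R in ha *.
set sg := g%:R * th - b%:~R in hb *.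
have detE : ((r%:Z * b - g%:Z * a)%:~R : R) = g%:R * rho - r%:R * sg.
  by rewrite rmorphB !rmorphM /= /rho /sg -!pmulrn; ring.
have det0 : r%:Z * b - g%:Z * a = 0.
  apply: int_eq0_small; rewrite detE.
  apply: (le_lt_trans (ler_normB _ _)).
  rewrite !normrM (ger0_norm (ltW g0')) (ger0_norm (ltW r0')).
  (* As [r <= g < L], this is at most [3 g d < 3 L d = 1]; the factor 3 in the definition of
     [returns] is chosen for this. *)
  apply: (@le_lt_trans _ _ (g%:R * (2 * d) + r%:R * d)).
    by apply: lerD; rewrite ler_pM2l.
  have h1 : r%:R * d <= g%:R * d by rewrite ler_pM2r.
  have h2 : (g%:R + 1) * d <= L%:R * d by rewrite ler_pM2r.
  lra.
have key : g%:R * rho = r%:R * sg.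
  by apply/eqP; rewrite -subr_eq0 -detE det0.
exists r%:Z, a; split.
- by rewrite lez_nat.
- by rewrite -PoszM lez_nat mulnC (leq_trans nur)// ltnW.
- rewrite -pmulrn -/rho invfM -/d.
  rewrite ler_pdivlMr//.
  have nurR : (nu%:R : R) * r%:R <= g%:R by rewrite -natrM ler_nat.
  have e : g%:R * `|rho| = r%:R * `|sg|.
    by move: (congr1 Num.norm key); rewrite !normrM (ger0_norm (ltW g0'))
      (ger0_norm (ltW r0')).
  rewrite -(ler_pM2l r0').
  have : r%:R * (`|rho| * nu%:R) <= g%:R * `|rho|.
    have -> : r%:R * (`|rho| * nu%:R) = (nu%:R * r%:R) * `|rho| by ring.
    by rewrite ler_wpM2r.
  rewrite e => /le_trans; apply.
  by rewrite ler_pM2l.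
Qed.

End Returns.

(** * Triangle weights, their second differences, and summation by parts *)

Section TriangleWeight.
Context {R : realType}.
Implicit Types (v s c : int) (L k : nat).

(** Twice as wide as the box [[-L, L]], so that the weight is at least [L] on it; piecewise linear,
    so that second differences are sparse. *)
Definition tri L v : int := if `|v| < (2 * L)%:Z then (2 * L)%:Z - `|v| else 0.

Lemma tri_ge0 L v : 0 <= tri L v.
Proof. by rewrite /tri; case: ifP => //; lia. Qed.

Lemma tri_le L v : tri L v <= (2 * L)%:Z.
Proof. by rewrite /tri; case: ifP; lia. Qed.

Lemma tri_ge L v : `|v| <= L%:Z -> L%:Z <= tri L v.
Proof. by rewrite /tri; case: ifP; lia. Qed.

Lemma tri_eq0 L v : (2 * L)%:Z <= `|v| -> tri L v = 0.
Proof. by rewrite /tri; case: ifP; lia. Qed.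

Lemma tri_lip L v : `|tri L (v + 1) - tri L v| <= 1.
Proof. by rewrite /tri; case: ifP; case: ifP; lia. Qed.

(** The slope changes only at the kinks [-2L], [0] and [2L], by 1, 2 and 1 in absolute value; the
    second difference is centred at [v + 1]. *)
Lemma tri_snd_diff L v : (0 < L)%N ->
  `|tri L v - 2 * tri L (v + 1) + tri L (v + 2)| <=
  (v + 1 == - (2 * L)%:Z)%:Z + 2 * (v + 1 == 0)%:Z + (v + 1 == (2 * L)%:Z)%:Z.
Proof.
rewrite /tri; do 3 case: ifP.
all: do 3 case: eqP.
all: lia.
Qed.

Lemma sum_indic_le1 n s c : \sum_(k < n) ((k%:Z + s == c)%:Z) <= 1.
Proof.
have -> : \sum_(k < n) ((k%:Z + s == c)%:Z) =
    (\sum_(k < n) nat_of_bool (k%:Z + s == c)%R)%N%:Z.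
  by elim/big_rec2 : _ => // i x y _ ->; rewrite PoszD.
rewrite lez_nat; apply: (@leq_trans #|[set k : 'I_n | k%:Z + s == c]|).
  by rewrite -sum1dep_card [leqRHS]big_mkcond leq_sum// => k _; case: eqP.
apply/card_le1_eqP => i j; rewrite !inE => /eqP hi /eqP hj.
by apply: ord_inj; lia.
Qed.

Lemma sum_tri_snd_diff L n s : (0 < L)%N ->
  \sum_(k < n) `|tri L (k%:Z + s) - 2 * tri L (k%:Z + s + 1)
    + tri L (k%:Z + s + 2)| <= 4.
Proof.
move=> L0.
apply: (@le_trans _ _ (\sum_(k < n) ((k%:Z + (s + 1) == - (2 * L)%:Z)%:Z
  + 2 * (k%:Z + (s + 1) == 0)%:Z + (k%:Z + (s + 1) == (2 * L)%:Z)%:Z))).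
  apply: ler_sum => k _.
  have -> : k%:Z + (s + 1) = k%:Z + s + 1 by ring.
  exact: tri_snd_diff.
rewrite !big_split /= -mulr_sumr.
have h2 : 0 <= 2 :> int by [].
exact: (lerD (lerD (sum_indic_le1 n (s + 1) (- (2 * L)%:Z))
  (ler_wpM2l h2 (sum_indic_le1 n (s + 1) 0)))
  (sum_indic_le1 n (s + 1) (2 * L)%:Z)).
Qed.

(* The shift moves the support into [2, 4L], so that sums over [k] have no
   boundary terms. *)
Definition tri2 L s k : int :=
  tri L (k%:Z - (2 * L).+1%:Z) * tri L (k%:Z - (2 * L).+1%:Z + s).

Lemma tri2_ge0 L s k : 0 <= tri2 L s k.
Proof. by rewrite mulr_ge0// tri_ge0. Qed.

Lemma tri2_le L s k : tri2 L s k <= (2 * L)%:Z ^+ 2.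
Proof. by rewrite expr2 ler_pM ?tri_ge0 ?tri_le. Qed.

Lemma tri2_eq0 L s k : (k < 2)%N || (4 * L < k)%N -> tri2 L s k = 0.
Proof. by move=> h; rewrite /tri2 tri_eq0 ?mul0r//; lia. Qed.

(* With a = f 0 - f 1, b = f 2 - f 1 and likewise for g, the second difference
   of f g is f 1 (c + d) + g 1 (a + b) + a c + b d. *)
Lemma sum_tri2_snd_diff L s : (0 < L)%N ->
  \sum_(k < 4 * L + 2) `|tri2 L s k - 2 * tri2 L s k.+1 + tri2 L s k.+2|
    <= (28 * L)%:Z.
Proof.
move=> L0; set m := (2 * L).+1%:Z.
apply: (@le_trans _ _ (\sum_(k < 4 * L + 2)
   ((2 * L)%:Z * `|tri L (k%:Z + (s - m)) - 2 * tri L (k%:Z + (s - m) + 1)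
                     + tri L (k%:Z + (s - m) + 2)|
  + (2 * L)%:Z * `|tri L (k%:Z + (- m)) - 2 * tri L (k%:Z + (- m) + 1)
                     + tri L (k%:Z + (- m) + 2)| + 2))).
  apply: ler_sum => k _; rewrite /tri2 -/m.
  have e1 : k.+1%:Z - m = k%:Z - m + 1 by lia.
  have e2 : k.+2%:Z - m = k%:Z - m + 2 by lia.
  rewrite e1 e2.
  have -> : k%:Z + (s - m) = k%:Z - m + s by ring.
  set v := k%:Z - m.
  have -> : v + 1 + s = v + s + 1 by ring.
  have -> : v + 2 + s = v + s + 2 by ring.
  have := tri_lip L v; have := tri_lip L (v + 1).
  have := tri_lip L (v + s); have := tri_lip L (v + s + 1).
  have -> : v + 1 + 1 = v + 2 by ring.
  have -> : v + s + 1 + 1 = v + s + 2 by ring.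
  have := tri_ge0 L (v + 1); have := tri_le L (v + 1).
  have := tri_ge0 L (v + s + 1); have := tri_le L (v + s + 1).
  move: (tri L v) (tri L (v + 1)) (tri L (v + 2)) => f0 f1 f2.
  move: (tri L (v + s)) (tri L (v + s + 1)) (tri L (v + s + 2)) => g0 g1 g2.
  move: (2 * L)%:Z => l g1l g10 f1l f10 hd hc hb ha.
  have -> : f0 * g0 - 2 * (f1 * g1) + f2 * g2 =
     f1 * (g0 - 2 * g1 + g2) + g1 * (f0 - 2 * f1 + f2)
     + ((f1 - f0) * (g1 - g0) + (f2 - f1) * (g2 - g1)) by ring.
  apply: (le_trans (ler_normD _ _)); apply: lerD.
    apply: (le_trans (ler_normD _ _)); rewrite !normrM.
    by apply: lerD; apply: ler_wpM2r => //; rewrite ger0_norm.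
  apply: (le_trans (ler_normD _ _)); rewrite !normrM.
  by apply: (@lerD _ _ 1 _ 1); apply: mulr_ile1.
rewrite !big_split /= -!mulr_sumr sumr_const card_ord.
have h1 := sum_tri_snd_diff L (4 * L + 2) (s - m) L0.
have h2 := sum_tri_snd_diff L (4 * L + 2) (- m) L0.
have l0 : 0 <= (2 * L)%:Z by [].
(* The total is [8L + 8L + 2(4L + 2) = 24L + 4], at most [28L] since [L >= 1]. *)
apply: (le_trans (lerD (lerD (ler_wpM2l l0 h1) (ler_wpM2l l0 h2)) (lexx _))).
rewrite natz; lia.
Qed.

Lemma sum_shift (V : nmodType) (F : nat -> V) n : F 0%N = 0 -> F n = 0 ->
  \sum_(k < n) F k.+1 = \sum_(k < n) F k.
Proof.
move=> F0 Fn; have : F 0%N + \sum_(k < n) F k.+1 = \sum_(k < n) F k + F n.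
  by rewrite -(big_ord_recr n (fun k : 'I_n.+1 => F k)) big_ord_recl.
by rewrite F0 Fn addr0 add0r.
Qed.

(** The factor [2 - 2 cos phi] is minus the symbol [e^(i phi) - 2 + e^(-i phi)] of a second
    difference. Writing the sum with its index shifted by 0, 1 and 2, one shift per term of the
    symbol, moves the difference onto [g]; the vanishing values of [g] remove boundary terms. *)
Lemma summation_by_parts2 (g : nat -> R) n (phi : R) :
  g 0%N = 0 -> g 1%N = 0 -> g n = 0 -> g n.+1 = 0 ->
  (2 - 2 * cos phi) * cabs (\sum_(k < n) Complex (g k) 0 * cis (phi * k%:R))
  <= \sum_(k < n) `|g k - 2 * g k.+1 + g k.+2|.
Proof.
move=> g0 g1 gn gn1.
pose F k := Complex (g k) 0 * cis (phi * k%:R).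
have F0 k : g k = 0 -> F k = 0 by rewrite /F => ->; rewrite -/(0 : R[i]) mul0r.
set G := \sum_(k < n) _; have GE : G = \sum_(k < n) F k by [].
have GE1 : G = \sum_(k < n) F k.+1.
  by rewrite (sum_shift _ F) ?F0.
have GE2 : G = \sum_(k < n) F k.+2.
  by rewrite (sum_shift _ (fun k => F k.+1)) ?F0.
have E : Complex (2 - 2 * cos phi) 0 * G =
  - \sum_(k < n) Complex (g k - 2 * g k.+1 + g k.+2) 0
                * cis (phi * k.+1%:R).
  have -> : Complex (2 - 2 * cos phi) 0 =
      - (cis phi - Complex 2 0 + conjc (cis phi)).
    by apply/eqP; rewrite eq_complex /=; apply/andP; split; apply/eqP; ring.
  rewrite mulNr; congr (- _).
  rewrite !mulrDl mulNr {1}GE {1}GE1 GE2 !mulr_sumr -sumrB -big_split /=.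
  apply: eq_bigr => k _; rewrite /F.
  have -> : phi * k.+1%:R = phi * k%:R + phi by rewrite -natr1; ring.
  have -> : phi * k.+2%:R = phi * k%:R + phi + phi.
    by rewrite -natr1 -natr1; ring.
  rewrite !cisD; case: (cis (phi * k%:R)) => x y; rewrite /cis /=.
  have := cos2Dsin2 phi; move: (cos phi) (sin phi) => a b ab.
  have {}ab : b * b = 1 - a * a by rewrite -ab; ring.
  by apply/eqP; rewrite eq_complex /=; apply/andP; split; apply/eqP; ring: ab.
have c0 : 0 <= 2 - 2 * cos phi by have := cos_le1 phi; lra.
rewrite -[X in X * _](ger0_norm c0) -cabs_real -cabsM E cabsN.
apply: (le_trans (cabs_sum _ _ _ _)); apply: ler_sum => k _.
by rewrite cabsM cabs_cis mulr1 cabs_real.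
Qed.

(** The mean value theorem gives slope at least [cos 1] on [[0, 1]]; between 1 and [pi / 2] the sine
    increases and so stays above [sin 1 >= cos 1], which dominates [cos 1 * x]. *)
Lemma sin_ge_linear (x : R) : 0 <= x <= 2^-1 -> cos 1 * x <= sin (pi * x).
Proof.
have c1 := @cos1_gt0 R; have pi2 := @pi_ge2 R.
have small (y : R) : 0 <= y <= 1 -> cos 1 * y <= sin y.
  move=> /andP[y0 y1].
  have dsin (z : R) : z \in `]0, y[ -> is_derive z 1 (@sin R) (cos z).
    by move=> _; exact: is_derive_sin.
  have csin : ({within `[0, y], continuous (@sin R)})%classic.
    by apply: continuous_subspaceT => z; exact: continuous_sin.
  have [z + ] := MVT_segment y0 dsin csin.
  rewrite in_itv /= sin0 !subr0 => /andP[z0 zy] ->.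
  apply: ler_wpM2r => //; rewrite leNgt; apply/negP => h.
  have z1 : z <= 1 by exact: le_trans zy y1.
  suff : 1 < z by rewrite ltNge z1.
  by rewrite -ltr_cos ?in_itv//=; lra.
move=> /andP[x0 x1].
have [y1|y1] := leP (pi * x) 1.
  apply: le_trans (small _ _); last by rewrite y1 andbT mulr_ge0// pi_ge0.
  by rewrite ler_pM2l// ler_peMl//; lra.
apply: (@le_trans _ _ (cos 1 * 1)); first by rewrite ler_pM2l//; lra.
apply: (le_trans (small 1 _)); first by rewrite ler01 lexx.
have ypi : pi * x <= pi / 2 by rewrite ler_pM2l// pi_gt0.
by apply: ltW; rewrite ltr_sin ?in_itv//=; apply/andP; split; lra.
Qed.

Definition dist_int (y : R) : R := Num.min (fpart y) (1 - fpart y).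

Lemma dist_int_ge0 y : 0 <= dist_int y.
Proof.
by have /andP[h1 h2] := fpart_itv y; rewrite le_min h1 /= subr_ge0 ltW.
Qed.

(** The right side is [4 sin^2(pi y)]; pass to the fractional part, reflect about 1/2 if needed, and
    use the linear lower bound for the sine. *)
Lemma cos_dist_int (y : R) :
  4 * cos 1 ^+ 2 * dist_int y ^+ 2 <= 2 - 2 * cos (2 * pi * y).
Proof.
have /andP[h1 h2] := fpart_itv y.
have -> : cos (2 * pi * y) = cos (2 * (pi * fpart y)).
  have : cis (2 * pi * y) = cis (2 * (pi * fpart y)) :> R[i].
    rewrite (_ : 2 * pi * y = 2 * (pi * fpart y)
      + 2 * pi * (Num.floor y)%:~R); last by rewrite /fpart; ring.
    by rewrite cisD cis2pi mulr1.
  by case.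
have -> : 2 - 2 * cos (2 * (pi * fpart y)) = 4 * sin (pi * fpart y) ^+ 2.
  by rewrite [2 * (pi * _)]mulr_natl cos_mulr2n cos2sin2; ring.
rewrite -mulrA ler_pM2l// -exprMn ler_sqr ?nnegrE; last 2 first.
- by rewrite mulr_ge0 ?dist_int_ge0// ltW// cos1_gt0.
- by apply: sin_ge0_pi; rewrite mulr_ge0 ?pi_ge0//= ler_piMr ?pi_ge0// ltW.
have [hh|hh] := leP (fpart y) 2^-1.
  apply: le_trans (sin_ge_linear _ _); last by rewrite h1 hh.
  by rewrite ler_pM2l ?cos1_gt0// ge_min lexx.
have -> : sin (pi * fpart y) = sin (pi * (1 - fpart y)).
  by rewrite [pi * (1 - _)]mulrBr mulr1 sinB sinpi cospi; ring.
apply: le_trans (sin_ge_linear _ _); last by apply/andP; split; lra.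
by rewrite ler_pM2l ?cos1_gt0// ge_min lexx orbT.
Qed.

End TriangleWeight.

(** * Weyl differencing for weighted quadratic exponential sums *)

Section WeylSum.
Context {R : realType}.
Implicit Types (L : nat).

(** Here [252 = 9 * 28]: the 28 bounds the second differences of [tri2], the 9 comes from measuring
    distances in units of [1/(3L)], and [cos 1] from the lower bound for the sine. *)
Definition weyl_const : R := 252 / cos 1 ^+ 2.

Lemma weyl_const_ge : 252 <= weyl_const.
Proof.
have c1 := @cos1_gt0 R; rewrite ler_pdivlMr ?exprn_gt0// ler_piMr//.
Qed.

Lemma dist_int_cell L (y : R) : (0 < L)%N ->
  (minn (cell L y) (3 * L - 1 - cell L y))%:R <= 3 * L%:R * dist_int y.
Proof.
move=> L0; have /andP[h1 h2] := cell_itv L y; have h3 := cell_lt L y L0.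
have L0' : (0 : R) < 3 * L%:R by rewrite mulr_gt0// ltr0n.
rewrite /dist_int minr_pMr ?(ltW L0')// le_min; apply/andP; split.
  by apply: le_trans h1; rewrite ler_nat geq_minl.
apply: (@le_trans _ _ (3 * L - 1 - cell L y)%:R).
  by rewrite ler_nat geq_minr.
have e : (3 * L - 1 - cell L y)%:R + (cell L y).+1%:R = 3 * L%:R :> R.
  by rewrite -natrD -natrM; congr (_%:R); lia.
rewrite [leRHS]mulrBr mulr1; move: h2 e.
by move: (cell L y).+1%:R (_%:R) => u v; lra.
Qed.

(** In the cells adjacent to an integer, bounding each term by its modulus suffices; elsewhere
    summation by parts gains the square of the distance to the integers. *)
Lemma tri2_sum_bound L (s : int) (phi : R) : (0 < L)%N ->
  cabs (\sum_(k < 4 * L + 2) Complex ((tri2 L s k)%:~R : R) 0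
                             * cis (2 * pi * phi * k%:R))
  <= weyl_const * L%:R ^+ 3 * cell_weight L (cell L phi).
Proof.
move=> L0; set G := cabs _.
have c1 := @cos1_gt0 R.
have L1 : (1 : R) <= L%:R by rewrite ler1n.
have G0 : 0 <= G by exact: cabs_ge0.
have triv : G <= 24 * L%:R ^+ 3.
  apply: (le_trans (cabs_sum _ _ _ _)).
  apply: (@le_trans _ _ (\sum_(k < 4 * L + 2) (4 * L%:R ^+ 2))).
    apply: ler_sum => k _; rewrite cabsM cabs_cis mulr1 cabs_real.
    rewrite ger0_norm ?ler0z ?tri2_ge0//.
    have -> : 4 * L%:R ^+ 2 = ((2 * L)%:Z ^+ 2)%:~R :> R.
      by rewrite rmorphXn /= -pmulrn natrM; ring.
    by rewrite ler_int tri2_le.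
  rewrite sumr_const card_ord -[leLHS]mulr_natr natrD natrM.
  have := mulr_ge0 (mulr_ge0 (ler0n R 8) (ler0n R L)) (ler0n R L).
  rewrite -subr_ge0 in L1; have := mulr_ge0 (sqr_ge0 (L%:R : R)) L1.
  by rewrite !exprS !expr0; lra.
have [n1 n2 n3 n4] : [/\ tri2 L s 0 = 0, tri2 L s 1 = 0,
    tri2 L s (4 * L + 2) = 0 & tri2 L s (4 * L + 2).+1 = 0].
  by split; apply: tri2_eq0; lia.
have parts : (2 - 2 * cos (2 * pi * phi)) * G <= 28 * L%:R.
  apply: le_trans (summation_by_parts2 (fun k => (tri2 L s k)%:~R) _ _ _ _ _ _) _;
    rewrite ?n1 ?n2 ?n3 ?n4//.
  have -> : 28 * L%:R = (28 * L)%:Z%:~R :> R by rewrite -pmulrn natrM.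
  apply: le_trans (_ : _ <= (\sum_(k < 4 * L + 2) `|tri2 L s k
     - 2 * tri2 L s k.+1 + tri2 L s k.+2|)%:~R) _; last first.
    by rewrite ler_int sum_tri2_snd_diff.
  rewrite rmorph_sum /=; apply: ler_sum => k _.
  by rewrite intr_norm intrD intrB intrM.
set q := minn (cell L phi) (3 * L - 1 - cell L phi).
have qd := dist_int_cell L phi L0; rewrite -/q in qd.
rewrite /cell_weight -/q.
have [q0|q0] := posnP q.
  rewrite q0 addr0 expr1n invr1 mulr1; apply: (le_trans triv).
  rewrite ler_pM2r ?exprn_gt0 ?(lt_le_trans ltr01)//.
  by apply: le_trans weyl_const_ge; lra.
have q1 : (1 : R) <= q%:R by rewrite ler1n.
have d2 : q%:R ^+ 2 <= 9 * L%:R ^+ 2 * dist_int phi ^+ 2.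
  have -> : 9 * L%:R ^+ 2 * dist_int phi ^+ 2 = (3 * L%:R * dist_int phi) ^+ 2.
    by ring.
  by rewrite ler_sqr ?nnegrE// (le_trans _ qd)// (le_trans _ q1).
have main : 4 * cos 1 ^+ 2 * q%:R ^+ 2 * G <= 252 * L%:R ^+ 3.
  apply: (@le_trans _ _ (9 * L%:R ^+ 2 * (28 * L%:R))); last first.
    by rewrite !exprS !expr0; lra.
  apply: (@le_trans _ _ (9 * L%:R ^+ 2 *
      ((4 * cos 1 ^+ 2 * dist_int phi ^+ 2) * G))).
    have -> : 9 * L%:R ^+ 2 * (4 * cos 1 ^+ 2 * dist_int phi ^+ 2 * G) =
      4 * cos 1 ^+ 2 * (9 * L%:R ^+ 2 * dist_int phi ^+ 2) * G by ring.
    rewrite ler_wpM2r// ler_wpM2l// mulr_ge0// sqr_ge0//.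
  rewrite ler_wpM2l ?mulr_ge0 ?sqr_ge0//; apply: le_trans parts.
  by rewrite ler_wpM2r// cos_dist_int.
rewrite ler_pdivlMr ?exprn_gt0 ?ltr_pwDl//.
rewrite /weyl_const mulrAC ler_pdivlMr ?exprn_gt0//.
apply: le_trans main.
have -> : G * (1 + q%:R) ^+ 2 * cos 1 ^+ 2 =
  (cos 1 ^+ 2 * G) * (1 + q%:R) ^+ 2 by ring.
have -> : 4 * cos 1 ^+ 2 * q%:R ^+ 2 * G = (cos 1 ^+ 2 * G) * (2 * q%:R) ^+ 2.
  by ring.
(* As [q >= 1], passing from [q] to [1 + q] costs a factor 4, which is the 4 of [cos_dist_int]. *)
have qq : (1 + q%:R) ^+ 2 <= (2 * q%:R) ^+ 2 :> R.
  by move: (q%:R : R) q1 => x x1; rewrite ler_sqr ?nnegrE; lra.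
by rewrite ler_wpM2l// mulr_ge0// sqr_ge0.
Qed.

(** The window of length [2n] starting at [j - n] still contains the support [[0, n)]. This lets all
    base points of an autocorrelation share one range of lags. *)
Lemma sum_int_shift (V : nmodType) (F : int -> V) (n j : nat) : (j <= n)%N ->
  (forall v : int, v < 0 \/ n%:Z <= v -> F v = 0) ->
  \sum_(h < 2 * n) F (h%:Z + j%:Z - n%:Z) = \sum_(l < n) F l%:Z.
Proof.
move=> jn F0.
have e : (2 * n = (n - j) + (n + j))%N by lia.
rewrite e !big_split_ord /= big1 ?add0r; last first.
  by move=> h _; apply: F0; have := ltn_ord h; lia.
rewrite [X in _ + X]big1 ?addr0; last first.
  by move=> h _; apply: F0; lia.
by apply: eq_bigr => l _; congr F; lia.
Qed.

Lemma sum_blocks_le (f : nat -> R) (n L : nat) (X : R) :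
  (forall a, \sum_(i < L) f (a * L + i)%N <= X) ->
  \sum_(h < n * L) f h <= n%:R * X.
Proof.
move=> fX; elim: n => [|n IH]; first by rewrite mul0n big_ord0 mul0r.
rewrite mulSnr big_split_ord /= -natr1 mulrDl mul1r.
exact: lerD.
Qed.

(* Weyl differencing: the autocorrelation at lag [h] is a linear exponential sum
   with frequency [2 th h] and weights [tri2 L h], which [tri2_sum_bound] estimates. *)
Lemma weyl_bound L (A B th : R) : (0 < L)%N ->
  cabs (\sum_(k < 4 * L + 2)
     let v := k%:Z - (2 * L).+1%:Z in
     Complex ((tri L v)%:~R : R) 0 *
     cis (A + B * v%:~R + 2 * pi * th * v%:~R ^+ 2)) ^+ 2
  <= 48 * weyl_const * L%:R ^+ 3 * #|returns L (2 * th)|%:R.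
Proof.
move=> L0; set n := (4 * L + 2)%N; set m := (2 * L).+1%:Z.
pose P (v : int) : R := A + B * v%:~R + 2 * pi * th * v%:~R ^+ 2.
pose Z (v : int) := Complex ((tri L v)%:~R : R) 0 * cis (P v).
have wc0 : 0 <= weyl_const by apply: le_trans weyl_const_ge; rewrite ler0n.
rewrite /= -/m; set K := \sum_(k < n) _.
have KE : K = \sum_(k < n) Z (k%:Z - m) by [].
have Kshift (k' : nat) : (k' < n)%N ->
    K = \sum_(h < 2 * n) Z (k'%:Z - m + (h%:Z - n%:Z)).
  move=> k'n; rewrite KE -(sum_int_shift _ (fun v => Z (v - m)) n k').
  - by apply: eq_bigr => h _; congr Z; ring.
  - exact: ltnW.
  - by move=> v vn; rewrite /Z tri_eq0 ?mul0r//; lia.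
have KK : K * conjc K = \sum_(h < 2 * n) \sum_(k < n)
    conjc (Z (k%:Z - m)) * Z (k%:Z - m + (h%:Z - n%:Z)).
  rewrite mulrC {1}KE rmorph_sum /= mulr_suml exchange_big /=.
  apply: eq_bigr => k _; rewrite (Kshift k)// mulr_sumr.
  by apply: eq_bigr => h _.
have -> : cabs K ^+ 2 = cabs (K * conjc K).
  by rewrite cabsM cabsJ expr2.
rewrite KK; apply: (le_trans (cabs_sum _ _ _ _)).
pose f (h : nat) : R := weyl_const * L%:R ^+ 3 *
  cell_weight L (cell L (2 * th * (h%:Z - n%:Z)%:~R)).
have f0 h : 0 <= f h.
  rewrite /f mulr_ge0//; first by rewrite mulr_ge0// exprn_ge0.
  by rewrite invr_ge0 exprn_ge0// addr_ge0.
apply: (@le_trans _ _ (\sum_(h < 2 * n) f h)).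
  apply: ler_sum => h _; set s : int := h%:Z - n%:Z.
  (* The part of [P (v + s) - P v], for [v = k - m], that does not depend on [k]; the rest is linear
     in [k] with frequency [2 th s]. *)
  pose c : R := P s - A - 4 * pi * th * s%:~R * m%:~R.
  have -> : \sum_(k < n) conjc (Z (k%:Z - m)) * Z (k%:Z - m + s) =
      cis c * \sum_(k < n) Complex ((tri2 L s k)%:~R : R) 0
                * cis (2 * pi * (2 * th * s%:~R) * k%:R).
    rewrite mulr_sumr; apply: eq_bigr => k _.
    have eP : P (k%:Z - m + s) =
        P (k%:Z - m) + (c + 2 * pi * (2 * th * s%:~R) * k%:R).
      rewrite /c /P !rmorphD !rmorphN /= -!pmulrn; ring.
    have conjM (z w : R[i]) : conjc (z * w) = conjc z * conjc w.
      exact: (rmorphM (@conjc R)).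
    have conjR (a : R) : conjc (Complex a 0) = Complex a 0.
      by rewrite /= oppr0.
    rewrite /Z eP (cisD (P _)) (cisD c) conjM conjR.
    have -> : Complex ((tri2 L s k)%:~R : R) 0 =
       Complex ((tri L (k%:Z - m))%:~R : R) 0 *
       Complex ((tri L (k%:Z - m + s))%:~R : R) 0.
      rewrite /tri2 -/m rmorphM /=; apply/eqP; rewrite eq_complex /=.
      by apply/andP; split; apply/eqP; ring.
    have := mulcJ (cis (P (k%:Z - m))); rewrite cabs_cis expr1n.
    set z := cis (P _); set y := cis c; set x := cis (2 * pi * _ * _).
    set u := Complex _ 0; set w := Complex _ 0; set v := Complex _ 0 => zz.
    have -> : w * conjc z * (v * (z * (y * x))) =
        w * v * y * x * (z * conjc z) by ring.
    by rewrite zz (_ : u = 1)//; ring.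
  by rewrite cabsM cabs_cis mul1r tri2_sum_bound.
(* The [2n = 8L + 4] lags are padded to 12 blocks of [L]. Along a block the frequency advances by
   [2 th], so the orbit bound applies with its constant 4, whence [48 = 12 * 4]. *)
apply: (@le_trans _ _ (\sum_(h < 12 * L) f h)).
  have -> : (12 * L = 2 * n + (4 * L - 4))%N by rewrite /n; lia.
  by rewrite [leRHS]big_split_ord /= lerDl sumr_ge0.
have -> : 48 * weyl_const * L%:R ^+ 3 * #|returns L (2 * th)|%:R =
  12%:R * (weyl_const * L%:R ^+ 3 * (4 * #|returns L (2 * th)|%:R)) by ring.
apply: sum_blocks_le => a.
rewrite -mulr_sumr; apply: ler_wpM2l; first by rewrite mulr_ge0// exprn_ge0.
apply: le_trans (sum_cell_weight_orbit L
  (2 * th * ((a * L)%:Z - n%:Z)%:~R) (2 * th) L0).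
rewrite le_eqVlt; apply/orP; left; apply/eqP; apply: eq_bigr => i _.
congr (cell_weight _ (cell _ _)).
by rewrite PoszD !rmorphB rmorphD /= -!pmulrn; ring.
Qed.

End WeylSum.

(** * Counting the times whose phase has many returns *)

Section Counting.
Context {R : realType}.

Lemma card_ord_itv (n : nat) (S : {set 'I_n}) (a b : R) : a <= b + 1 ->
  (forall j, j \in S -> a <= j%:R <= b) -> #|S|%:R <= b - a + 1.
Proof.
move=> ab Sab; have [->|[i0 i0S]] := set_0Vmem S.
  by rewrite cards0; lra.
case: (arg_minnP (fun i : 'I_n => nat_of_ord i) i0S) => j0 j0S j0min.
case: (arg_maxnP (fun i : 'I_n => nat_of_ord i) i0S) => j1 j1S j1max.
have /andP[a0 _] := Sab _ j0S; have /andP[_ b1] := Sab _ j1S.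
have j01 : (j0 <= j1)%N by exact: j0min.
pose f (i : 'I_n) : 'I_(j1 - j0).+1 := inord (i - j0).
have fE i : i \in S -> f i = (i - j0)%N :> nat.
  by move=> iS; rewrite inordK// ltnS leq_sub2r//; exact: j1max.
have finj : {in S &, injective f}.
  move=> i i' iS i'S /(congr1 (@nat_of_ord _)); rewrite !fE// => e.
  have := j0min _ iS; have := j0min _ i'S => h h'.
  by apply: ord_inj; rewrite -(subnK h) -(subnK h') e.
have : (#|S| <= (j1 - j0).+1)%N.
  by rewrite -(card_in_imset finj) (leq_trans (max_card _))// card_ord.
rewrite -(ler_nat R) => /le_trans; apply.
by rewrite -natr1 natrB//; lra.
Qed.

Lemma card_union_bound (T I : finType) (S : {set T}) (P : pred I)
    (F : I -> {set T}) :
  (forall j, j \in S -> exists2 x, P x & j \in F x) ->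
  (#|S| <= \sum_(x | P x) #|F x|)%N.
Proof.
move=> h; apply: (@leq_trans #|\bigcup_(x | P x) F x|).
  apply: subset_leq_card; apply/fintype.subsetP => j /h[x Px jx].
  by apply/bigcupP; exists x.
elim/big_rec2 : _ => [|x m A _ IH]; first by rewrite cards0.
by apply: (leq_trans (leq_card_setU _ _).1); rewrite leq_add2l.
Qed.

Lemma absz_shift (a : int) (m : nat) : `|a| <= m%:Z ->
  (0 <= a + m%:Z) /\ (absz (a + m%:Z)%R < (2 * m).+1)%N.
Proof. lia. Qed.

Context (L : nat) (t : nat -> R) (L0 : (0 < L)%N).
Context (tbin : forall j, (j < L ^ 2)%N ->
  j%:R <= L%:R ^+ 2 * t j <= j%:R + 1).

(** A time determines its index up to 1: [L^2 t j - 1 <= j <= L^2 t j]. *)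
Lemma card_times_near (u D : R) : 0 <= D ->
  #|[set j : 'I_(L ^ 2) | `|t j - u| <= D]|%:R <= 2 * L%:R ^+ 2 * D + 2.
Proof.
move=> D0.
have LR : (0 : R) <= L%:R ^+ 2 by exact: sqr_ge0.
have LD : (0 : R) <= L%:R ^+ 2 * D by rewrite mulr_ge0.
apply: le_trans (card_ord_itv _ _ (L%:R ^+ 2 * (u - D) - 1)
  (L%:R ^+ 2 * (u + D)) _ _) _; [lra| |lra].
move=> j; rewrite inE ler_distl => /andP[h1 h2].
have /andP[h3 h4] := tbin j (ltn_ord j).
have := ler_wpM2l LR h1; have := ler_wpM2l LR h2.
by lra.
Qed.

Context (C y b : R) (A : nat) (C1 : 1 < C) (bC : C^-1 <= `|b|).
Context (thA : forall j, (j < L ^ 2)%N -> `|y + b * t j| <= A%:R).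

(** The nearby integer has absolute value at most [r (A + 1)], which leaves at most [3 r (A + 1)]
    choices, and each confines [t j] to an interval of radius proportional to [1/r]. The powers of
    [r] cancel, so the bound is the same for all multipliers. *)
Lemma card_near_multiple (r mu : nat) : (0 < r)%N -> (0 < mu)%N ->
  (r * mu <= L)%N ->
  #|[set j : 'I_(L ^ 2) |
      `[< near_int (r%:R * (y + b * t j)) (3 * L%:R * mu%:R)^-1 >]]|%:R
  <= 9 * C * A.+1%:R * (L%:R / mu%:R).
Proof.
move=> r0 mu0 rmu; set e : R := (3 * L%:R * mu%:R)^-1; set S := [set j | _].
have L0' : (0 : R) < L%:R by rewrite ltr0n.
have r0' : (0 : R) < r%:R by rewrite ltr0n.
have mu0' : (0 : R) < mu%:R by rewrite ltr0n.
have C0 : 0 < C by apply: lt_trans C1.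
have b0 : 0 < `|b| by apply: lt_le_trans bC; rewrite invr_gt0.
have bn0 : b != 0 by rewrite -normr_gt0.
have e0 : 0 < e by rewrite invr_gt0 !mulr_gt0.
have e1 : e <= 1.
  rewrite invf_le1 ?mulr_gt0// -!natrM ler1n; lia.
pose m := (r * A.+1)%N.
pose F (i : 'I_(2 * m).+1) : {set 'I_(L ^ 2)} :=
  [set j : 'I_(L ^ 2) |
    `|t j - ((i%:R - m%:R) / r%:R - y) / b| <= e * C / r%:R].
have SF j : j \in S -> exists2 i, xpredT i & j \in F i.
  rewrite inE => /asboolP[a ha].
  have h1 : `|a%:~R| <= m%:R :> R.
    have -> : a%:~R = r%:R * (y + b * t j) - (r%:R * (y + b * t j) - a%:~R).
      by ring.
    apply: (le_trans (ler_normB _ _)).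
    apply: (@le_trans _ _ (r%:R * A%:R + 1)).
      apply: lerD; last exact: le_trans ha e1.
      by rewrite normrM ger0_norm// ler_wpM2l// thA.
    by rewrite /m natrM -natr1 mulrDr lerD2l mulr1 ler1n.
  have h2 : `|a| <= m%:Z by rewrite -(ler_int R) intr_norm -pmulrn.
  have [am h3] := absz_shift _ _ h2.
  exists (Ordinal h3) => //; rewrite inE /=.
  have -> : (absz (a + m%:Z))%:R - m%:R = a%:~R :> R.
    rewrite [X in X - _ = _]pmulrn gez0_abs//.
    by rewrite rmorphD /= -pmulrn; ring.
  have -> : t j - (a%:~R / r%:R - y) / b =
     (r%:R * (y + b * t j) - a%:~R) / (r%:R * b).
    by field; rewrite bn0 gt_eqF.
  rewrite normrM normfV normrM (ger0_norm (ltW r0')).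
  rewrite invfM mulrA mulrAC ler_pM2r ?invr_gt0//.
  apply: (@le_trans _ _ (e * `|b|^-1)).
    by rewrite ler_pM2r ?invr_gt0.
  by rewrite ler_pM2l// invf_ple ?posrE.
have := card_union_bound _ _ _ _ _ SF; rewrite -(ler_nat R) => /le_trans; apply.
rewrite natr_sum.
have LM : 1 <= L%:R / (mu%:R * r%:R) :> R.
  by rewrite ler_pdivlMr ?mulr_gt0// mul1r -natrM ler_nat mulnC.
apply: (@le_trans _ _ (\sum_(i < (2 * m).+1) (3 * C * (L%:R / (mu%:R * r%:R))))).
  apply: ler_sum => i _; apply: (le_trans (card_times_near _ _ _)).
    exact: ltW (divr_gt0 (mulr_gt0 e0 C0) r0').
  have -> : 2 * L%:R ^+ 2 * (e * C / r%:R) =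
     (2 / 3) * (C * (L%:R / (mu%:R * r%:R))).
    by rewrite /e; field; rewrite !gt_eqF.
  (* This absorbs the additive 2 of [card_times_near], as [2/3 + 2 <= 3]. *)
  have h : 1 <= C * (L%:R / (mu%:R * r%:R)).
    by apply: (le_trans LM); rewrite ler_peMl ?(ltW C1)// (le_trans ler01).
  by rewrite -[3 * C * _]mulrA; move: (C * _) h => z; lra.
rewrite sumr_const card_ord -[leLHS]mulr_natr.
have -> : 9 * C * A.+1%:R * (L%:R / mu%:R) =
    3 * C * (L%:R / (mu%:R * r%:R)) * (3 * m)%:R.
  by rewrite /m !natrM; field; rewrite !gt_eqF.
rewrite ler_wpM2l ?ler_nat//; last by rewrite /m; lia.
by rewrite !mulr_ge0// ?invr_ge0 ?mulr_ge0// ltW.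
Qed.

(** More than [mu] returns yield a multiplier [r <= L / mu] to which [card_near_multiple] applies;
    its bound is independent of [r], so summing over [r] squares [L / mu]. *)
Lemma card_many_returns (mu : nat) : (0 < mu)%N ->
  #|[set j : 'I_(L ^ 2) | (mu < #|returns L (y + b * t j)|)%N]|%:R
  <= 9 * C * A.+1%:R * (L%:R / mu%:R) ^+ 2.
Proof.
move=> mu0; set S := [set j | _].
have mu0' : (0 : R) < mu%:R by rewrite ltr0n.
have L0' : (0 : R) < L%:R by rewrite ltr0n.
have C0 : 0 < C by apply: lt_trans C1.
pose F (i : 'I_(L %/ mu)) : {set 'I_(L ^ 2)} := [set j : 'I_(L ^ 2) |
  `[< near_int (i.+1%:R * (y + b * t j)) (3 * L%:R * mu%:R)^-1 >]].
have SF j : j \in S -> exists2 i, xpredT i & j \in F i.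
  rewrite inE => h.
  case E : #|returns L (y + b * t j)| h => [//|nu]; rewrite ltnS => munu.
  have nu0 : (0 < nu)%N by exact: leq_trans munu.
  have [r [a [r1 rnu hr]]] := returns_structure _ _ _ nu0 E.
  case: r r1 rnu hr => // -[//|r] _ rnu hr.
  have rmu : (r.+1 * mu <= L)%N.
    by move: rnu; rewrite -PoszM lez_nat; apply: leq_trans; rewrite leq_mul2l munu orbT.
  have rL : (r < L %/ mu)%N by rewrite leq_divRL.
  exists (Ordinal rL) => //; rewrite inE; apply/asboolP; exists a => /=.
  rewrite -pmulrn in hr; apply: (le_trans hr).
  have nu0' : (0 : R) < nu%:R by rewrite ltr0n.
  by rewrite lef_pV2 ?posrE ?mulr_gt0// ler_pM2l ?mulr_gt0// ler_nat.
have := card_union_bound _ _ _ _ _ SF; rewrite -(ler_nat R) => /le_trans; apply.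
rewrite natr_sum.
apply: (@le_trans _ _ (\sum_(i < L %/ mu) (9 * C * A.+1%:R * (L%:R / mu%:R)))).
  apply: ler_sum => i _; apply: card_near_multiple => //.
  by rewrite -leq_divRL.
rewrite sumr_const card_ord -[leLHS]mulr_natr.
rewrite [leRHS](_ : _ = 9 * C * A.+1%:R * (L%:R / mu%:R) * (L%:R / mu%:R));
  last by ring.
rewrite ler_wpM2l//.
  by rewrite !mulr_ge0// ?invr_ge0// ltW.
by rewrite ler_pdivlMr// -natrM ler_nat leq_divM.
Qed.

End Counting.

(** * Moments of the number of returns *)

Section MomentOfReturns.
Context {R : realType}.

Lemma geom_sum_le (q : R) (n : nat) : 1 < q ->
  \sum_(k < n.+1) q ^+ k <= q / (q - 1) * q ^+ n.
Proof.
move=> q1; have q0 : 0 < q - 1 by rewrite subr_gt0.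
rewrite mulrAC -exprS ler_pdivlMr// mulrC -subrX1 gerBl//.
Qed.

(** Only the largest power of 2 not exceeding [nu] is used; the full sum is kept because its range
    does not depend on [nu], so that a sum over times can be exchanged with it. *)
Lemma powR_dyadic_le (p : R) (nu n : nat) : 0 <= p -> (0 < nu)%N ->
  (nu < 2 ^ n.+1)%N ->
  nu%:R `^ p <= 2 `^ p * \sum_(k < n.+1)
    (((2 ^ k)%N <= nu)%N%:R * (2 ^ k)%:R `^ p).
Proof.
move=> p0 nu0 nun; set k0 := trunc_log 2 nu.
have /andP[h1 h2] := trunc_log_bounds (isT : (1 < 2)%N) nu0.
have k0n : (k0 < n.+1)%N.
  by rewrite -(ltn_exp2l _ _ (isT : (1 < 2)%N)) (leq_ltn_trans h1).
rewrite (bigD1 (Ordinal k0n))//= h1 mul1r.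
apply: (@le_trans _ _ (2 `^ p * (2 ^ k0)%:R `^ p)).
  rewrite -powRM// -natrM -expnS.
  by apply: ge0_ler_powR => //; rewrite ?nnegrE// ler_nat ltnW.
rewrite ler_wpM2l ?powR_ge0// lerDl.
by apply: sumr_ge0 => i _; rewrite mulr_ge0// powR_ge0.
Qed.

Lemma powR_sqr_split (x p : R) : 0 < x -> x `^ p = x ^+ 2 * x `^ (p - 2).
Proof.
move=> x0; rewrite -powR_mulrn ?ltW// -powRD; first by rewrite addrC subrK.
by rewrite (gt_eqF x0) implybT.
Qed.

Lemma natX_powR (k : nat) (s : R) : (2 ^ k)%:R `^ s = (2 `^ s) ^+ k.
Proof.
rewrite natrX -(powR_mulrn k (ler0n R 2)) -powRrM mulrC powRrM.
by rewrite powR_mulrn ?powR_ge0.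
Qed.

Context (L : nat) (t : nat -> R) (L0 : (0 < L)%N).
Context (tbin : forall j, (j < L ^ 2)%N ->
  j%:R <= L%:R ^+ 2 * t j <= j%:R + 1).
Context (C y b : R) (A : nat) (C1 : 1 < C) (bC : C^-1 <= `|b|).
Context (thA : forall j, (j < L ^ 2)%N -> `|y + b * t j| <= A%:R).

(** The scale [2^k] contributes at most a constant times [L^2 q^k] with [q = 2^(p-2) > 1], so the
    geometric sum is governed by the top scale, which is at most [L]. The summand 1 accounts for the
    times with a single return. *)
Lemma sum_returns_powR_le (p : R) : 2 < p ->
  \sum_(j < L ^ 2) (#|returns L (y + b * t j)|%:R `^ p)
  <= (1 + 4 `^ p * (9 * C * A.+1%:R) *
       (2 `^ (p - 2) / (2 `^ (p - 2) - 1))) * L%:R `^ p.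
Proof.
move=> p2; set D := 9 * C * _.
have p0 : 0 <= p by apply: ltW; apply: lt_trans p2.
have C0 : 0 < C by apply: lt_trans C1.
have D0 : 0 <= D by rewrite !mulr_ge0// ltW.
have L1 : (1 : R) <= L%:R by rewrite ler1n.
have L0' : (0 : R) < L%:R by rewrite ltr0n.
set q := 2 `^ (p - 2).
have one_pow : 1 `^ (p - 2) = 1 :> R by rewrite powR1.
have q1 : 1 < q.
  rewrite /q -[X in X < _]one_pow; apply: gt0_ltr_powR; rewrite ?nnegrE//.
    by rewrite subr_gt0.
  by rewrite ltr1n.
set n := trunc_log 2 L.
have /andP[h1 h2] := trunc_log_bounds (isT : (1 < 2)%N) L0.
pose N j := #|returns L (y + b * t j)|.
have NL j : (N j <= L)%N by rewrite (leq_trans (max_card _))// card_ord.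
apply: (@le_trans _ _ (\sum_(j < L ^ 2) (1 + 4 `^ p *
   \sum_(k < n.+1) ((2 ^ k < N j)%N%:R * (2 ^ k)%:R `^ p)))).
  apply: ler_sum => j _; rewrite -/(N j).
  case E : (N j) => [|[|nu]].
  - rewrite powR0 ?gt_eqF ?(lt_trans _ p2)// addr_ge0// mulr_ge0 ?powR_ge0//.
    by apply: sumr_ge0 => k _; rewrite mulr_ge0// powR_ge0.
  - rewrite powR1 lerDl mulr_ge0 ?powR_ge0//.
    by apply: sumr_ge0 => k _; rewrite mulr_ge0// powR_ge0.
  (* Of the 4, one factor 2 pays for replacing the count by the count minus 1, since the scales are
     compared with it strictly; the other is dyadic rounding. *)
  - apply: ler_wpDl => //.
    apply: (@le_trans _ _ (2 `^ p * nu.+1%:R `^ p)).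
      rewrite -powRM// -natrM; apply: ge0_ler_powR => //; rewrite ?nnegrE//.
      by rewrite ler_nat; lia.
    have -> : (4 : R) = 2 * 2 by ring.
    rewrite powRM// -mulrA ler_wpM2l ?powR_ge0//.
    apply: powR_dyadic_le => //.
    by apply: leq_ltn_trans h2; have := NL j; rewrite E; exact: ltnW.
rewrite big_split /= sumr_const card_ord -mulr_sumr exchange_big /=.
have LE : L%:R `^ p = L%:R ^+ 2 * L%:R `^ (p - 2).
  exact: powR_sqr_split.
rewrite mulrDl mul1r; apply: lerD.
  rewrite natrX LE ler_peMr ?exprn_ge0//.
  by rewrite -[X in X <= _]one_pow ge0_ler_powR ?nnegrE//; lra.
rewrite -mulrA -mulrA ler_wpM2l ?powR_ge0//.
apply: (@le_trans _ _ (\sum_(k < n.+1) (D * L%:R ^+ 2) * q ^+ k)).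
  apply: ler_sum => k _; rewrite -mulr_suml.
  have -> : \sum_(j < L ^ 2) ((2 ^ k < N j)%N%:R : R) =
     #|[set j : 'I_(L ^ 2) | (2 ^ k < N j)%N]|%:R.
    rewrite -sum1dep_card natr_sum [RHS]big_mkcond /=.
    by apply: eq_bigr => j _; case: ifP.
  have k0 : (0 < 2 ^ k)%N by rewrite expn_gt0.
  apply: (@le_trans _ _ ((D * (L%:R / (2 ^ k)%:R) ^+ 2) * (2 ^ k)%:R `^ p)).
    by rewrite ler_wpM2r ?powR_ge0//; exact: (card_many_returns L t L0 tbin C).
  have x0 : (0 : R) < (2 ^ k)%:R by rewrite ltr0n.
  have -> : (2 ^ k)%:R `^ p = (2 ^ k)%:R ^+ 2 * (2 ^ k)%:R `^ (p - 2) :> R.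
    exact: powR_sqr_split.
  rewrite natX_powR -/q.
  rewrite expr_div_n mulrA -[_ * _ * _ ^+ 2]mulrA divfK//.
rewrite -mulr_sumr LE.
apply: (@le_trans _ _ (D * L%:R ^+ 2 * (q / (q - 1) * q ^+ n))).
  by rewrite ler_wpM2l ?geom_sum_le// mulr_ge0// exprn_ge0// ltW.
have -> : D * (q / (q - 1) * (L%:R ^+ 2 * L%:R `^ (p - 2))) =
  D * L%:R ^+ 2 * (q / (q - 1) * L%:R `^ (p - 2)) by ring.
apply: ler_wpM2l; first by rewrite mulr_ge0// exprn_ge0.
apply: ler_wpM2l; first by rewrite divr_ge0 ?subr_ge0 ?powR_ge0 ?(ltW q1).
rewrite /q -natX_powR.
by rewrite ge0_ler_powR ?nnegrE// ?ler_nat//; lra.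
Qed.

End MomentOfReturns.

(** * A Schur test adapted to the dual form *)

Section DualityArgument.
Context {R : realType}.

Lemma sum_Cauchy_Schwarz (I : Type) (r : seq I) (x y : I -> R) :
  (\sum_(i <- r) x i * y i) ^+ 2
  <= (\sum_(i <- r) x i ^+ 2) * (\sum_(i <- r) y i ^+ 2).
Proof.
set X := \sum_(i <- r) x i ^+ 2; set Y := \sum_(i <- r) y i ^+ 2.
set Z := \sum_(i <- r) x i * y i.
have : 0 <= \sum_(i <- r) \sum_(j <- r) (x i * y j - x j * y i) ^+ 2.
  by apply: sumr_ge0 => i _; apply: sumr_ge0 => j _; exact: sqr_ge0.
have -> : \sum_(i <- r) \sum_(j <- r) (x i * y j - x j * y i) ^+ 2 =
    \sum_(i <- r) \sum_(j <- r) (x i ^+ 2 * y j ^+ 2 + y i ^+ 2 * x j ^+ 2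
      - 2 * ((x i * y i) * (x j * y j))).
  by apply: eq_bigr => i _; apply: eq_bigr => j _; ring.
under eq_bigr do rewrite sumrB big_split /= -!mulr_sumr.
rewrite sumrB big_split /= -!mulr_suml -mulr_sumr -mulr_suml -/X -/Y -/Z.
by rewrite expr2; lra.
Qed.

(* Split according to whether [k <= d v]. *)
Lemma powR_split_le (p v k d : R) : 1 < p -> 0 <= v -> 0 <= k -> 0 < d ->
  v `^ (2 * p - 1) * k <= d * v `^ (2 * p) + d `^ (1 - p) * (v `^ p * k `^ p).
Proof.
move=> p1 v0 k0 d0.
have [kdv|dvk] := leP k (d * v).
  apply: ler_wpDr; first by rewrite !mulr_ge0 ?powR_ge0.
  apply: (@le_trans _ _ (v `^ (2 * p - 1) * (d * v))).
    by rewrite ler_wpM2l ?powR_ge0.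
  rewrite mulrCA mulrC [_ * v]mulrC mulr_powRB1// 1?mulrC//; lra.
apply: ler_wpDl; first by rewrite !mulr_ge0 ?powR_ge0// ltW.
have kpos : 0 < k by apply: le_lt_trans dvk; rewrite mulr_ge0// ltW.
have -> : v `^ (2 * p - 1) = v `^ p * v `^ (p - 1).
  rewrite -powRD; first by congr (_ `^ _); ring.
  apply/implyP => /eqP h; exfalso; lra.
have -> : k `^ p = k * k `^ (p - 1) by rewrite mulr_powRB1//; lra.
have h : v `^ (p - 1) <= d `^ (1 - p) * k `^ (p - 1).
  have -> : 1 - p = - (p - 1) by ring.
  rewrite powRN mulrC ler_pdivlMr ?powR_gt0// -powRM//; last exact: ltW.
  apply: ge0_ler_powR; rewrite ?nnegrE ?mulr_ge0//; try lra.
have -> : d `^ (1 - p) * (v `^ p * (k * k `^ (p - 1))) =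
   v `^ p * (d `^ (1 - p) * k `^ (p - 1)) * k by ring.
by rewrite ler_wpM2r// ler_wpM2l ?powR_ge0.
Qed.

(** Splitting by [powR_split_le] gives [d S^2] plus [d^(1-p)] times the sum of
    [(U i U j)^p (k i j)^p], which is at most [S A] by [xy <= (x^2 + y^2)/2] and the row and column
    bounds. Then [S^2] cancels, and what remains, [1 <= 2 B d], bounds [S]. *)
Lemma schur_self_improvement (n : nat) (U : 'I_n -> R) (k : 'I_n -> 'I_n -> R)
    (p A B : R) :
  1 < p -> 0 < A -> 0 <= B -> (forall i, 0 <= U i) ->
  (forall i j, 0 <= k i j) ->
  (forall i, \sum_j k i j `^ p <= A) -> (forall j, \sum_i k i j `^ p <= A) ->
  (\sum_i U i `^ (2 * p)) ^+ 2
    <= B * \sum_i \sum_j (U i * U j) `^ (2 * p - 1) * k i j ->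
  \sum_i U i `^ (2 * p) <= 2 `^ p * B `^ p * A.
Proof.
move=> p1 A0 B0 U0 k0 rowA colA; set S := \sum_i U i `^ (2 * p) => hS.
have S0 : 0 <= S by apply: sumr_ge0 => i _; exact: powR_ge0.
have p0 : 0 < p by lra.
move: S0; rewrite le_eqVlt => /predU1P[<-|S0].
  by rewrite !mulr_ge0 ?powR_ge0// ltW.
(* This value balances the two terms: [d^(1-p) S A = d S^2]. *)
set d := (A / S) `^ p^-1.
have d0 : 0 < d by rewrite powR_gt0// divr_gt0.
have dp : d `^ p = A / S.
  by rewrite -powRrM mulVf ?gt_eqF// powRr1// ltW// divr_gt0.
have sq (z : R) : 0 <= z -> z `^ (2 * p) = (z `^ p) ^+ 2.
  by move=> z0; rewrite mulrC powRrM powR_mulrn ?powR_ge0.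
have : S ^+ 2 <= B * (2 * d * S ^+ 2).
  apply: (le_trans hS); rewrite ler_wpM2l//.
  apply: (@le_trans _ _ (\sum_i \sum_j (d * (U i * U j) `^ (2 * p) +
     d `^ (1 - p) * ((U i * U j) `^ p * k i j `^ p)))).
    by apply: ler_sum => i _; apply: ler_sum => j _; rewrite powR_split_le// mulr_ge0.
  have -> : 2 * d * S ^+ 2 = d * S ^+ 2 + d `^ (1 - p) * (S * A).
    have -> : d `^ (1 - p) = d / d `^ p.
      rewrite powRD ?powRr1 ?powRN// ?(ltW d0)//.
      by rewrite (gt_eqF d0) implybT.
    by rewrite dp; field; rewrite !gt_eqF.
  under eq_bigr do rewrite big_split /= -!mulr_sumr.
  rewrite big_split /= -!mulr_sumr; apply: lerD.
    rewrite ler_pM2l// expr2 /S mulr_suml ler_sum// => i _.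
    by rewrite mulr_sumr ler_sum// => j _; rewrite powRM.
  rewrite ler_pM2l ?powR_gt0 ?divr_gt0//.
  apply: (@le_trans _ _ (\sum_i \sum_j (U i `^ (2 * p) * k i j `^ p / 2
      + U j `^ (2 * p) * k i j `^ p / 2))).
    apply: ler_sum => i _; apply: ler_sum => j _.
    rewrite powRM// !sq//; set x := U i `^ p; set y := U j `^ p.
    rewrite [leRHS](_ : _ = (x ^+ 2 / 2 + y ^+ 2 / 2) * k i j `^ p); last by ring.
    by rewrite ler_wpM2r ?powR_ge0//; have := sqr_ge0 (x - y); lra.
  under eq_bigr do rewrite big_split /=.
  rewrite big_split /= [X in _ + X]exchange_big /=.
  have half : S * A = S * A / 2 + S * A / 2 by field.
  rewrite half; apply: lerD.
    rewrite /S !mulr_suml ler_sum// => i _.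
    by rewrite -mulr_suml -mulr_sumr ler_wpM2r// ler_wpM2l ?powR_ge0.
  rewrite /S !mulr_suml ler_sum// => i _.
  by rewrite -mulr_suml -mulr_sumr ler_wpM2r// ler_wpM2l ?powR_ge0.
have -> : B * (2 * d * S ^+ 2) = (2 * B * d) * S ^+ 2 by ring.
rewrite ler_pMl ?exprn_gt0// => h.
have {}h : 1 `^ p <= (2 * B * d) `^ p.
  by apply: ge0_ler_powR; rewrite ?nnegrE ?mulr_ge0// ltW.
move: h; rewrite powR1 !powRM ?mulr_ge0// ?(ltW d0)// dp mulrA.
by rewrite ler_pdivlMr// mul1r.
Qed.

End DualityArgument.

(** * The discrete estimate at one point per time bin *)

Section DiscreteStrichartz.
Context {R : realType}.

Lemma ler_sum_uniq_image (T : eqType) (I : finType) (pt : I -> T) (s : seq T)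
    (f : T -> R) : uniq s -> (forall n, 0 <= f n) ->
  (forall n, n \in s -> exists k, pt k = n) ->
  \sum_(n <- s) f n <= \sum_k f (pt k).
Proof.
move=> us f0 sp.
case: s us sp => [|n0 s'] us sp.
  by rewrite big_nil sumr_ge0.
have [k0 _] := sp n0 (mem_head _ _).
pose g n := odflt k0 [pick k | pt k == n].
have gK n : n \in n0 :: s' -> pt (g n) = n.
  move=> /sp[k ptk]; rewrite /g; case: pickP => [k' /eqP//|/(_ k)].
  by rewrite ptk eqxx.
move: us gK {sp}; move: (n0 :: s') => s us gK.
have -> : \sum_(n <- s) f n = \sum_(k <- map g s) f (pt k).
  by rewrite big_map; apply: eq_big_seq => n /gK ->.
rewrite big_uniq /=; last first.
  by rewrite map_inj_in_uniq// => n n' /gK {2}<- /gK {2}<- ->.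
rewrite big_mkcond; apply: ler_sum => k _.
by case: ifP.
Qed.

Definition phase (a1 a2 : R) (n : Z2) (x : R * R) (t : R) : R :=
  2 * pi * (dotZ n x + Qform a1 a2 n * t).

Definition lattice_point (L : nat) (c : Z2)
    (k : 'I_(4 * L + 2) * 'I_(4 * L + 2)) : Z2 :=
  (c.1 + (k.1%:Z - (2 * L).+1%:Z), c.2 + (k.2%:Z - (2 * L).+1%:Z)).

Definition lattice_weight (L : nat) (k : 'I_(4 * L + 2) * 'I_(4 * L + 2)) : R :=
  (tri L (k.1%:Z - (2 * L).+1%:Z))%:~R * (tri L (k.2%:Z - (2 * L).+1%:Z))%:~R.

Lemma lattice_weight_ge0 L k : 0 <= lattice_weight L k.
Proof. by rewrite mulr_ge0// ler0z tri_ge0. Qed.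

Lemma recenter (z c : int) (L : nat) : `|z - c| <= L%:Z ->
  (absz (z - c + (2 * L).+1%:Z)%R < 4 * L + 2)%N /\
  c + ((absz (z - c + (2 * L).+1%:Z)%R)%:Z - (2 * L).+1%:Z) = z.
Proof. lia. Qed.

(** Each triangle factor is at least [L] on the box, whence [L^2]. An arbitrary subset [s] of the
    box is thereby replaced by a smoothed full square, over which sums of characters factor. *)
Lemma ler_sum_lattice (L : nat) (c : Z2) (s : seq Z2) (f : Z2 -> R) :
  (0 < L)%N -> uniq s -> (forall n, 0 <= f n) ->
  (forall n : Z2, n \in s -> `|n.1 - c.1| <= L%:Z /\ `|n.2 - c.2| <= L%:Z) ->
  L%:R ^+ 2 * \sum_(n <- s) f n
    <= \sum_k lattice_weight L k * f (lattice_point L c k).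
Proof.
move=> L0 us f0 sc.
pose w (n : Z2) : R := (tri L (n.1 - c.1))%:~R * (tri L (n.2 - c.2))%:~R.
have w0 n : 0 <= w n by rewrite mulr_ge0// ler0z tri_ge0.
apply: (@le_trans _ _ (\sum_(n <- s) w n * f n)).
  rewrite mulr_sumr big_seq [leRHS]big_seq; apply: ler_sum => n /sc[n1 n2].
  rewrite ler_wpM2r// expr2 pmulrn ler_pM ?ler0z ?ler_int ?tri_ge//.
have -> : \sum_k lattice_weight L k * f (lattice_point L c k) =
    \sum_k (fun n => w n * f n) (lattice_point L c k).
  apply: eq_bigr => k _ /=; congr (_ * _); rewrite /w /lattice_weight /=.
  by congr ((tri _ _)%:~R * (tri _ _)%:~R); ring.
apply: ler_sum_uniq_image => // [n|n /sc[n1 n2]]; first by rewrite mulr_ge0.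
have [h1 e1] := recenter _ _ _ n1; have [h2 e2] := recenter _ _ _ n2.
exists (Ordinal h1, Ordinal h2).
by rewrite /lattice_point /= e1 e2 -surjective_pairing.
Qed.

Definition weyl_sum (L : nat) (A B th : R) : R[i] :=
  \sum_(k < 4 * L + 2)
     let v := k%:Z - (2 * L).+1%:Z in
     Complex ((tri L v)%:~R : R) 0 *
     cis (A + B * v%:~R + 2 * pi * th * v%:~R ^+ 2).

(** Expanding around [c] changes only the constant and linear coefficients of the phase, in which
    [weyl_bound] is uniform; the quadratic ones remain [a1 (t - t')] and [a2 (t - t')]. *)
Lemma lattice_kernel_factors (L : nat) (c : Z2) (a1 a2 : R) (x x' : R * R)
    (t t' : R) :
  \sum_k Complex (lattice_weight L k) 0 *
     (cis (phase a1 a2 (lattice_point L c k) x t) *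
      conjc (cis (phase a1 a2 (lattice_point L c k) x' t')))
  = weyl_sum L
      (2 * pi * (c.1%:~R * (x.1 - x'.1) + a1 * c.1%:~R ^+ 2 * (t - t')))
      (2 * pi * (x.1 - x'.1 + 2 * a1 * c.1%:~R * (t - t'))) (a1 * (t - t')) *
    weyl_sum L
      (2 * pi * (c.2%:~R * (x.2 - x'.2) + a2 * c.2%:~R ^+ 2 * (t - t')))
      (2 * pi * (x.2 - x'.2 + 2 * a2 * c.2%:~R * (t - t'))) (a2 * (t - t')).
Proof.
under [LHS]eq_bigr do rewrite -cisN -cisD.
rewrite /weyl_sum big_distrlr /= pair_bigA /=; apply: eq_bigr => -[k1 k2] _ /=.
rewrite mulrACA -cisD; congr (_ * cis _).
  rewrite /lattice_weight /=; apply/eqP; rewrite eq_complex /=.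
  by apply/andP; split; apply/eqP; ring.
rewrite /phase /dotZ /Qform /lattice_point /=.
move: (k1%:Z - _) (k2%:Z - _) => v1 v2; rewrite !intrD.
by ring.
Qed.

(** Exchange the sums, apply Cauchy-Schwarz in [n], enlarge the sum of [|D n|^2] to the weighted
    lattice and expand the square: the coefficients [a] split off and a kernel in pairs of points
    remains. *)
Lemma dual_sum_bound (J L : nat) (s : seq Z2) (c : Z2) (a : Z2 -> R[i])
    (a1 a2 : R) (x : 'I_J -> R * R) (t : 'I_J -> R) (b : 'I_J -> R[i]) :
  (0 < L)%N -> uniq s ->
  (forall n : Z2, n \in s -> `|n.1 - c.1| <= L%:Z /\ `|n.2 - c.2| <= L%:Z) ->
  L%:R ^+ 2 *
  cabs (\sum_j b j * \sum_(n <- s) a n * cis (phase a1 a2 n (x j) (t j))) ^+ 2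
  <= (\sum_(n <- s) cabs (a n) ^+ 2) *
     \sum_i \sum_j (cabs (b i) * cabs (b j)) *
       (24 * weyl_const * L%:R ^+ 3 *
        (#|returns L (2 * (a1 * (t i - t j)))|%:R
         + #|returns L (2 * (a2 * (t i - t j)))|%:R)).
Proof.
move=> L0 us sc.
pose D n := \sum_j b j * cis (phase a1 a2 n (x j) (t j)).
have -> : \sum_j b j * \sum_(n <- s) a n * cis (phase a1 a2 n (x j) (t j)) =
    \sum_(n <- s) a n * D n.
  under eq_bigr do rewrite mulr_sumr.
  rewrite exchange_big /=; apply: eq_bigr => n _; rewrite mulr_sumr.
  by apply: eq_bigr => j _; rewrite mulrCA.
apply: (@le_trans _ _ (L%:R ^+ 2 * ((\sum_(n <- s) cabs (a n) ^+ 2) *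
    (\sum_(n <- s) cabs (D n) ^+ 2)))).
  rewrite ler_wpM2l ?sqr_ge0//.
  apply: le_trans (sum_Cauchy_Schwarz _ _ _ _).
  rewrite ler_sqr ?nnegrE ?cabs_ge0//; last first.
    by apply: sumr_ge0 => n _; rewrite mulr_ge0 ?cabs_ge0.
  apply: (le_trans (cabs_sum _ _ _ _)).
  by apply: ler_sum => n _; rewrite cabsM.
rewrite mulrCA ler_wpM2l//; first by apply: sumr_ge0 => n _; exact: sqr_ge0.
apply: (le_trans (ler_sum_lattice L c s (fun n => cabs (D n) ^+ 2) L0 us _ sc)).
  by move=> n; exact: sqr_ge0.
set W := (X in X <= _); set K := fun i j => \sum_k Complex (lattice_weight L k) 0 *
     (cis (phase a1 a2 (lattice_point L c k) (x i) (t i)) *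
      conjc (cis (phase a1 a2 (lattice_point L c k) (x j) (t j)))).
have WE : Complex W 0 = \sum_i \sum_j (b i * conjc (b j)) * K i j.
  have -> : Complex W 0 = \sum_k Complex (lattice_weight L k) 0
      * (D (lattice_point L c k) * conjc (D (lattice_point L c k))).
    rewrite /W (big_morph (fun y : R => Complex y 0 : R[i])
      (id1 := 0) (op1 := +%R)) //; last first.
      by move=> y z; apply/eqP; rewrite eq_complex /= addr0 !eqxx.
    apply: eq_bigr => k _; rewrite mulcJ; apply/eqP.
    by rewrite eq_complex /= !mulr0 mul0r subr0 addr0 !eqxx.
  have conjE n : conjc (D n) =
      \sum_j conjc (b j) * conjc (cis (phase a1 a2 n (x j) (t j))).
    rewrite /D (rmorph_sum (@conjc R)); apply: eq_bigr => j _.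
    exact: (rmorphM (@conjc R)).
  under eq_bigr => k _ do rewrite conjE big_distrlr mulr_sumr.
  rewrite exchange_big; apply: eq_bigr => i _.
  under eq_bigr => k _ do rewrite mulr_sumr.
  rewrite exchange_big; apply: eq_bigr => j _.
  rewrite /K [RHS]mulr_sumr; apply: eq_bigr => k _.
  set e1 := cis _; set e2 := conjc (cis _); set w := Complex _ _.
  change (w * (b i * e1 * (conjc (b j) * e2))
    = b i * conjc (b j) * (w * (e1 * e2))).
  by ring.
have W0 : 0 <= W.
  by apply: sumr_ge0 => k _; rewrite mulr_ge0 ?sqr_ge0 ?lattice_weight_ge0.
have -> : W = cabs (Complex W 0) by rewrite cabs_real ger0_norm.
rewrite WE; apply: (le_trans (cabs_sum _ _ _ _)); apply: ler_sum => i _.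
apply: (le_trans (cabs_sum _ _ _ _)); apply: ler_sum => j _.
rewrite !cabsM cabsJ ler_wpM2l ?mulr_ge0 ?cabs_ge0//.
rewrite /K lattice_kernel_factors cabsM.
set K1 := weyl_sum _ _ _ _; set K2 := weyl_sum _ _ _ _.
have h1 : cabs K1 ^+ 2 <= 48 * weyl_const * L%:R ^+ 3 *
    #|returns L (2 * (a1 * (t i - t j)))|%:R := weyl_bound _ _ _ _ L0.
have h2 : cabs K2 ^+ 2 <= 48 * weyl_const * L%:R ^+ 3 *
    #|returns L (2 * (a2 * (t i - t j)))|%:R := weyl_bound _ _ _ _ L0.
(* Half the sum of the squares bounds the product; this turns 48 into 24 and decouples [a1] from
   [a2]. *)
have := sqr_ge0 (cabs K1 - cabs K2); rewrite sqrrB.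
lra.
Qed.

Lemma discrete_strichartz (C p : R) : 1 < C -> 2 < p ->
  exists2 K : R, 0 < K &
  forall (L : nat) (s : seq Z2) (c : Z2) (a : Z2 -> R[i]) (a1 a2 : R)
    (x : nat -> R * R) (t : nat -> R),
  (0 < L)%N -> uniq s ->
  (forall n : Z2, n \in s -> `|n.1 - c.1| <= L%:Z /\ `|n.2 - c.2| <= L%:Z) ->
  C^-1 < a1 < C -> C^-1 < a2 < C ->
  (forall j, (j < L ^ 2)%N -> j%:R <= L%:R ^+ 2 * t j <= j%:R + 1) ->
  \sum_(j < L ^ 2)
     cabs (\sum_(n <- s) a n * cis (phase a1 a2 n (x j) (t j))) `^ (2 * p)
  <= K * L%:R `^ (2 * p) * (\sum_(n <- s) cabs (a n) ^+ 2) `^ p.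
Proof.
move=> C1 p2.
have C0 : 0 < C by apply: lt_trans C1.
have p1 : 1 < p by lra.
have p0 : 0 < p by lra.
(* Bounds every [|2 a (t i - t j)|], as [a < C] and the times lie in [[0, 1]]. *)
pose A := (Num.truncn (2 * C)).+1.
have CA : 2 * C <= A%:R.
  by have /andP[_ /ltW] := truncn_itv (mulr_ge0 (ler0n R 2) (ltW C0)).
pose K1 := 1 + 4 `^ p * (9 * C * A.+1%:R) *
       (2 `^ (p - 2) / (2 `^ (p - 2) - 1)).
have K1_gt0 : 0 < K1.
  rewrite ltr_pwDl// mulr_ge0//; first by rewrite !mulr_ge0 ?powR_ge0// ltW.
  rewrite divr_ge0 ?powR_ge0// subr_ge0.
  have one_pow : 1 `^ (p - 2) = 1 :> R by rewrite powR1.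
  by rewrite -[X in X <= _]one_pow; apply: ge0_ler_powR; rewrite ?nnegrE//; lra.
have wc0 : 0 < @weyl_const R by apply: lt_le_trans weyl_const_ge; rewrite ltr0n.
pose K2 := (48 * weyl_const) `^ p * (2 * K1).
have w48 : 0 < 48 * weyl_const :> R by apply: mulr_gt0 => //; rewrite ltr0n.
have K2_gt0 : 0 < K2.
  by apply: mulr_gt0; [exact: powR_gt0|apply: mulr_gt0].
exists (2 `^ p * K2).
  by apply: mulr_gt0 => //; apply: powR_gt0.
move=> L s c a a1 a2 x t L0 us sc /andP[a1C a1C'] /andP[a2C a2C'] tbin.
have L0' : (0 : R) < L%:R by rewrite ltr0n.
pose u (j : 'I_(L ^ 2)) :=
  \sum_(n <- s) a n * cis (phase a1 a2 n (x j) (t j)).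
have w48L : 0 <= 48 * weyl_const * L%:R :> R by rewrite mulr_ge0// ltW.
have w24L : 0 <= 24 * weyl_const * L%:R :> R.
  by rewrite mulr_ge0// mulr_ge0// ltW.
pose B := \sum_(n <- s) cabs (a n) ^+ 2.
have B0 : 0 <= B by apply: sumr_ge0 => n _; exact: sqr_ge0.
pose k (i j : 'I_(L ^ 2)) : R := 24 * weyl_const * L%:R *
        (#|returns L (2 * (a1 * (t i - t j)))|%:R
         + #|returns L (2 * (a2 * (t i - t j)))|%:R).
have t01 j : (j < L ^ 2)%N -> 0 <= t j <= 1.
  move=> jL; have /andP[h1 h2] := tbin j jL.
  have L2 : (0 : R) < L%:R ^+ 2 by rewrite exprn_gt0.
  rewrite -(pmulr_rge0 _ L2) (le_trans _ h1)//=.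
  rewrite -(ler_pM2l L2) mulr1 (le_trans h2)//.
  by rewrite -natrX natr1 ler_nat.
(* Stated for general [y] and [b] because rows of the kernel have [b = - 2 al] and columns
   [b = 2 al]. *)
have moment (al y b : R) : C^-1 < al < C -> `|b| = 2 * al ->
    (forall j, (j < L ^ 2)%N -> `|y + b * t j| <= 2 * al) ->
    \sum_(j < L ^ 2) #|returns L (y + b * t j)|%:R `^ p <= K1 * L%:R `^ p.
  move=> /andP[h1 h2] hb hy.
  apply: (sum_returns_powR_le L t L0 tbin C) => //.
    rewrite hb (le_trans (ltW h1))// ler_peMl ?ler1n//.
    by rewrite ltW// (lt_trans _ h1)// invr_gt0.
  by move=> j jL; apply: (le_trans (hy j jL)); apply: le_trans CA; rewrite ler_pM2l// ltW.
have pair (n1 n2 : nat) : (24 * weyl_const * L%:R * (n1%:R + n2%:R)) `^ p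
    <= (48 * weyl_const * L%:R) `^ p * (n1%:R `^ p + n2%:R `^ p) :> R.
  have h (m : nat) : n1%:R + n2%:R <= 2 * m%:R :> R ->
      (24 * weyl_const * L%:R * (n1%:R + n2%:R)) `^ p
      <= (48 * weyl_const * L%:R) `^ p * m%:R `^ p :> R.
    move=> hm; rewrite -powRM//.
    apply: ge0_ler_powR; rewrite ?nnegrE.
    - exact: ltW.
    - by apply: mulr_ge0 => //; apply: addr_ge0.
    - exact: mulr_ge0.
    have -> : 48 * weyl_const * L%:R * m%:R =
      24 * weyl_const * L%:R * (2 * m%:R) :> R by ring.
    by rewrite ler_wpM2l.
  have q0 : 0 <= (48 * weyl_const * L%:R) `^ p :> R by exact: powR_ge0.
  have [n12|n21] := leqP n1 n2.
    apply: (le_trans (h n2 _)); first by rewrite mulr_natl mulr2n lerD2r ler_nat.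
    by rewrite ler_wpM2l// lerDr powR_ge0.
  apply: (le_trans (h n1 _)); first by rewrite mulr_natl mulr2n lerD2l ler_nat ltnW.
  by rewrite ler_wpM2l// lerDl powR_ge0.
have AE : (48 * weyl_const * L%:R) `^ p *
    (K1 * L%:R `^ p + K1 * L%:R `^ p) = K2 * L%:R `^ (2 * p).
  rewrite (powRM _ (mulr_ge0 (ler0n R 48) (ltW wc0)) (ltW L0')).
  have -> : L%:R `^ (2 * p) = L%:R `^ p * L%:R `^ p :> R.
    rewrite -powRD; first by congr (_ `^ _); ring.
    by rewrite (gt_eqF L0') implybT.
  by rewrite /K2; ring.
have tdist (al : R) i j : 0 <= al -> (i < L ^ 2)%N -> (j < L ^ 2)%N ->
    `|2 * (al * (t i - t j))| <= 2 * al.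
  move=> al0 /t01/andP[h1 h2] /t01/andP[h3 h4].
  rewrite !normrM (ger0_norm al0) ger0_norm// mulrA ler_piMr ?mulr_ge0//.
  by rewrite ler_norml; apply/andP; split; lra.
have alg0 (al : R) : C^-1 < al -> 0 <= al.
  by move=> h; rewrite ltW// (lt_trans _ h)// invr_gt0.
have da (al : R) : C^-1 < al -> 0 <= 2 * al.
  by move=> /alg0 h; rewrite mulr_ge0.
apply: (@le_trans _ _ (2 `^ p * B `^ p * (K2 * L%:R `^ (2 * p)))); last first.
  rewrite le_eqVlt; apply/orP; left; apply/eqP; rewrite -/B; ring.
apply: (schur_self_improvement _ (fun j => cabs (u j)) k) => //.
- by rewrite mulr_gt0 ?powR_gt0 ?ltr0n.
- by move=> i; exact: cabs_ge0.
- by move=> i j; apply: mulr_ge0 => //; apply: addr_ge0.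
- move=> i; rewrite -AE.
  apply: (le_trans (ler_sum _ (fun j _ => pair _ _))).
  rewrite -mulr_sumr ler_wpM2l ?powR_ge0// big_split /=; apply: lerD.
    rewrite (eq_bigr (fun j : 'I_(L ^ 2) =>
      #|returns L (2 * a1 * t i + (- (2 * a1)) * t j)|%:R `^ p)); last first.
      by move=> j _; congr (#|returns L _|%:R `^ p); ring.
    apply: (moment a1); [by rewrite a1C|by rewrite normrN ger0_norm// da|].
    move=> j jL; have -> : 2 * a1 * t i + - (2 * a1) * t j =
      2 * (a1 * (t i - t j)) by ring.
    by rewrite tdist// alg0.
  rewrite (eq_bigr (fun j : 'I_(L ^ 2) =>
    #|returns L (2 * a2 * t i + (- (2 * a2)) * t j)|%:R `^ p)); last first.
    by move=> j _; congr (#|returns L _|%:R `^ p); ring.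
  apply: (moment a2); [by rewrite a2C|by rewrite normrN ger0_norm// da|].
  move=> j jL; have -> : 2 * a2 * t i + - (2 * a2) * t j =
    2 * (a2 * (t i - t j)) by ring.
  by rewrite tdist// alg0.
- move=> j; rewrite -AE.
  apply: (le_trans (ler_sum _ (fun i _ => pair _ _))).
  rewrite -mulr_sumr ler_wpM2l ?powR_ge0// big_split /=; apply: lerD.
    rewrite (eq_bigr (fun i : 'I_(L ^ 2) =>
      #|returns L (- (2 * a1 * t j) + 2 * a1 * t i)|%:R `^ p)); last first.
      by move=> i _; congr (#|returns L _|%:R `^ p); ring.
    apply: (moment a1); [by rewrite a1C|by rewrite ger0_norm// da|].
    move=> i iL; have -> : - (2 * a1 * t j) + 2 * a1 * t i =
      2 * (a1 * (t i - t j)) by ring.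
    by rewrite tdist// alg0.
  rewrite (eq_bigr (fun i : 'I_(L ^ 2) =>
    #|returns L (- (2 * a2 * t j) + 2 * a2 * t i)|%:R `^ p)); last first.
    by move=> i _; congr (#|returns L _|%:R `^ p); ring.
  apply: (moment a2); [by rewrite a2C|by rewrite ger0_norm// da|].
  move=> i iL; have -> : - (2 * a2 * t j) + 2 * a2 * t i =
    2 * (a2 * (t i - t j)) by ring.
  by rewrite tdist// alg0.
(* Extremal dual weights: [b j * u j = |u j|^(2p)], so the pairing is the very sum to be bounded,
   and [|b j| = |u j|^(2p-1)] is the power in the Schur test. *)
pose b (j : 'I_(L ^ 2)) :=
  Complex (cabs (u j) `^ (2 * p - 2)) 0 * conjc (u j).
have babs j : cabs (b j) = cabs (u j) `^ (2 * p - 1).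
  rewrite cabsM cabs_real cabsJ ger0_norm ?powR_ge0//.
  have -> : 2 * p - 2 = 2 * p - 1 - 1 by ring.
  by rewrite mulrC mulr_powRB1 ?cabs_ge0//; lra.
have bu j : b j * u j = Complex (cabs (u j) `^ (2 * p)) 0.
  rewrite /b -mulrA [conjc _ * _]mulrC mulcJ.
  rewrite (_ : cabs (u j) `^ (2 * p) =
    cabs (u j) `^ (2 * p - 2) * cabs (u j) ^+ 2).
    by apply/eqP; rewrite eq_complex /= !mulr0 !mul0r subr0 addr0 !eqxx.
  rewrite -powR_mulrn ?cabs_ge0// -powRD; first by congr (_ `^ _); ring.
  by apply/implyP => /eqP h; exfalso; lra.
have := dual_sum_bound (L ^ 2) L s c a a1 a2 x t b L0 us sc.
have -> : \sum_j b j * (\sum_(n <- s) a n * cis (phase a1 a2 n (x j) (t j)))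
    = Complex (\sum_j cabs (u j) `^ (2 * p)) 0.
  rewrite (big_morph (fun y : R => Complex y 0 : R[i])
      (id1 := 0) (op1 := +%R)) //.
    by apply: eq_bigr => j _; rewrite -bu.
  by move=> y z; apply/eqP; rewrite eq_complex /= addr0 !eqxx.
rewrite cabs_real ger0_norm; last by apply: sumr_ge0 => j _; exact: powR_ge0.
rewrite -/B.
(* Of the [L^3] in the kernel bound, [L^2] cancels the lower bound of the lattice weights; one [L]
   stays in [k]. *)
have -> : \sum_i \sum_j cabs (b i) * cabs (b j) *
   (24 * weyl_const * L%:R ^+ 3 *
    (#|returns L (2 * (a1 * (t i - t j)))|%:R +
     #|returns L (2 * (a2 * (t i - t j)))|%:R))
  = L%:R ^+ 2 * \sum_i \sum_j (cabs (u i) * cabs (u j)) `^ (2 * p - 1) * k i j.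
  rewrite mulr_sumr; apply: eq_bigr => i _; rewrite mulr_sumr.
  apply: eq_bigr => j _; rewrite !babs powRM ?cabs_ge0// /k.
  by ring.
by rewrite [X in _ <= X -> _]mulrCA ler_pM2l// exprn_gt0.
Qed.

End DiscreteStrichartz.

Local Open Scope classical_set_scope.

(** * Integration on the torus and orthogonality of characters *)

Section TorusFourier.
Context {R : realType}.

Local Notation plane := (measurableTypeR R * measurableTypeR R)%type.
Local Notation mu := (@plane_measure R).
Local Notation D := (@unit_square R).
Local Notation leb := (@lebesgue_measure R).

Lemma measurable_unit_square : measurable (D : set plane).
Proof. by apply: measurableX; exact: measurable_itv. Qed.

Lemma plane_measure_unit_square : mu D = 1%E.
Proof.
pose I : set (measurableTypeR R) := `[0, 1].
transitivity (leb I * leb I)%E.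
  by apply: product_measure1E; exact: measurable_itv.
by rewrite /I lebesgue_measure_itv/= lte_fin ltr01 oppr0 adde0 mule1.
Qed.

Lemma bounded_integrable_square (g : plane -> R) (M : R) :
  measurable_fun [set: plane] g -> (forall x, `|g x| <= M) ->
  mu.-integrable D (EFin \o g).
Proof.
move=> mg gM; apply: measurable_bounded_integrable.
- exact: measurable_unit_square.
- by rewrite -[ltLHS]/(mu D) plane_measure_unit_square ltry.
- exact: measurable_funTS.
- exists M; split; first exact: num_real.
  by move=> r Mr x _; apply: (le_trans (gM x)); exact: ltW.
Qed.

Lemma lebesgue_unit_interval :
  leb (`[0, 1] : set (measurableTypeR R)) = 1%E.
Proof. by rewrite lebesgue_measure_itv/= lte_fin ltr01 oppr0 adde0. Qed.

(** Fubini on the whole plane, after cutting both functions off to the unit interval. *)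
Lemma Rintegral_square_prod (h k : R -> R) (M : R) :
  measurable_fun [set: measurableTypeR R] h ->
  measurable_fun [set: measurableTypeR R] k ->
  (forall x, `|h x| <= M) -> (forall x, `|k x| <= M) ->
  (\int[mu]_(x in D) (h x.1 * k x.2))%R =
  ((\int[leb]_(x in `[0, 1]) h x) * (\int[leb]_(x in `[0, 1]) k x))%R.
Proof.
move=> mh mk hM kM; pose I : set (measurableTypeR R) := `[0, 1].
have mI : measurable I by exact: measurable_itv.
have ext (g : R -> R) : measurable_fun [set: measurableTypeR R] g ->
    (forall x, `|g x| <= M) -> leb.-integrable setT (EFin \o (g \_ I)).
  move=> mg gM; rewrite -restrict_EFin; apply/(integrable_mkcond _ mI).
  apply: measurable_bounded_integrable => //.
  - by rewrite -[ltLHS]/(leb I) lebesgue_unit_interval ltry.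
  - exact: measurable_funTS.
  - exists M; split; first exact: num_real.
    by move=> r Mr x _; apply: (le_trans (gM x)); exact: ltW.
have RE (g : R -> R) : (\int[leb]_(x in I) g x)%R =
    fine (\int[leb]_x ((g \_ I) x)%:E)%E.
  by rewrite /Rintegral integral_mkcond restrict_EFin.
rewrite -/I !RE /Rintegral integral_mkcond.
have patchE : ((fun x : plane => (h x.1 * k x.2)%:E) \_ D) =
    (fun x : plane => ((h \_ I) x.1)%:E * ((k \_ I) x.2)%:E)%E.
  apply/funext => -[x y]; rewrite !patchE /unit_square in_setX /=.
  by case: (x \in I); case: (y \in I); rewrite /= ?mule0 ?mul0e// EFinM.
have iD : mu.-integrable setT
    (fun x : plane => ((h \_ I) x.1)%:E * ((k \_ I) x.2)%:E)%E.
  rewrite -patchE; apply/(integrable_mkcond _ measurable_unit_square).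
  apply: (bounded_integrable_square _ (M * M)).
    apply: measurable_funM.
      exact: (measurableT_comp mh measurable_fst).
    exact: (measurableT_comp mk measurable_snd).
  by move=> x; rewrite normrM ler_pM.
rewrite patchE -(integral12_prod_meas1 iD) /fubini_F /=.
under eq_integral => x _.
  rewrite (integralZl measurableT (ext k mk kM)) /=.
  over.
rewrite -[(\int[leb]_x ((k \_ I) x)%:E)%E]fineK; last first.
  exact: (integrable_fin_num measurableT (ext k mk kM)).
rewrite (integralZr measurableT (ext h mh hM)) fineM//.
exact: (integrable_fin_num measurableT (ext h mh hM)).
Qed.

Lemma Rintegral_derive (F f : R -> R) : continuous f ->
  (forall x : R, is_derive x 1 F (f x)) ->
  (\int[leb]_(x in `[0, 1]) f x)%R = F 1 - F 0.
Proof.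
move=> cf dF; rewrite /Rintegral (@continuous_FTC2 _ _ F)//.
- exact: continuous_subspaceT.
- have cF x : {for x, continuous F}.
    by apply: differentiable_continuous; apply/derivable1_diffP; case: (dF x).
  split.
  + by move=> x _; case: (dF x).
  + exact: cvg_at_right_filter (cF 0).
  + exact: cvg_at_left_filter (cF 1).
- by move=> x _; rewrite derive1E; exact: derive_val.
Qed.

Lemma Rintegral_cos_2pi (m : int) :
  (\int[leb]_(x in `[0, 1]) cos (2 * pi * (m%:~R * x)))%R = (m == 0)%:R :> R.
Proof.
have [->|m0] := eqVneq m 0.
  rewrite (_ : (fun x : R => _) = cst 1); last first.
    by apply/funext => x; rewrite mul0r mulr0 cos0.
  rewrite Rintegral_cst; last exact: measurable_itv.
  by rewrite [X in fine X]lebesgue_unit_interval mul1r.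
pose w : R := 2 * pi * m%:~R.
have w0 : w != 0 by rewrite !mulf_neq0 ?intr_eq0// gt_eqF// pi_gt0.
rewrite (_ : (fun x : R => _) = (fun x => cos (w * x))); last first.
  by apply/funext => x; rewrite /w mulrA.
have cf : continuous (fun x : R => cos (w * x)).
  move=> x; apply: continuous_comp; last exact: continuous_cos.
  exact: mulrl_continuous.
have dF (x : R) : is_derive x 1 (fun x => w^-1 * sin (w * x)) (cos (w * x)).
  have d1 : is_derive x 1 (fun y : R => w * y) w.
    by apply: is_derive_eq; rewrite -[RHS]mulr1.
  have d2 := is_derive1_comp (is_derive_sin (w * x)) d1.
  apply: (is_derive_eq (is_deriveZ w^-1 d2)).
  by rewrite /GRing.scale /= mulrCA mulVf// mulr1.
rewrite (Rintegral_derive _ _ cf dF) mulr0 sin0 mulr0 subr0 mulr1.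
have := @cis2pi R m; rewrite -/w => -[_ ->].
by rewrite mulr0.
Qed.

Lemma Rintegral_sin_2pi (m : int) :
  (\int[leb]_(x in `[0, 1]) sin (2 * pi * (m%:~R * x)))%R = 0 :> R.
Proof.
have [->|m0] := eqVneq m 0.
  rewrite (_ : (fun x : R => _) = cst 0); last first.
    by apply/funext => x; rewrite mul0r mulr0 sin0.
  by rewrite Rintegral_cst ?mul0r//; exact: measurable_itv.
pose w : R := 2 * pi * m%:~R.
have w0 : w != 0 by rewrite !mulf_neq0 ?intr_eq0// gt_eqF// pi_gt0.
rewrite (_ : (fun x : R => _) = (fun x => sin (w * x))); last first.
  by apply/funext => x; rewrite /w mulrA.
have cf : continuous (fun x : R => sin (w * x)).
  move=> x; apply: continuous_comp; last exact: continuous_sin.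
  exact: mulrl_continuous.
have dF (x : R) : is_derive x 1 (fun x => - w^-1 * cos (w * x)) (sin (w * x)).
  have d1 : is_derive x 1 (fun y : R => w * y) w.
    by apply: is_derive_eq; rewrite -[RHS]mulr1.
  have d2 := is_derive1_comp (is_derive_cos (w * x)) d1.
  apply: (is_derive_eq (is_deriveZ (- w^-1) d2)).
  by rewrite /GRing.scale /=; field.
rewrite (Rintegral_derive _ _ cf dF) mulr0 cos0 !mulr1.
have := @cis2pi R m; rewrite -/w => -[-> _].
by rewrite mulr1 subrr.
Qed.

Definition cmeasurable (f : plane -> R[i]) : Prop :=
  measurable_fun [set: plane] (fun x => complex.Re (f x)) /\
  measurable_fun [set: plane] (fun x => complex.Im (f x)).

Definition cintegrable (f : plane -> R[i]) : Prop :=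
  mu.-integrable D (EFin \o (fun x => complex.Re (f x))) /\
  mu.-integrable D (EFin \o (fun x => complex.Im (f x))).

Lemma cmeasurableD f g : cmeasurable f -> cmeasurable g ->
  cmeasurable (fun x => f x + g x).
Proof.
move=> [f1 f2] [g1 g2]; split.
- have -> : (fun x => complex.Re (f x + g x)) =
    (fun x => complex.Re (f x)) \+ (fun x => complex.Re (g x)).
    by apply/funext => x /=; case: (f x) => ? ?; case: (g x).
  exact: measurable_funD.
- have -> : (fun x => complex.Im (f x + g x)) =
    (fun x => complex.Im (f x)) \+ (fun x => complex.Im (g x)).
    by apply/funext => x /=; case: (f x) => ? ?; case: (g x).
  exact: measurable_funD.
Qed.

Lemma cmeasurableM f g : cmeasurable f -> cmeasurable g ->
  cmeasurable (fun x => f x * g x).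
Proof.
move=> [f1 f2] [g1 g2]; split.
- have -> : (fun x => complex.Re (f x * g x)) =
    ((fun x => complex.Re (f x)) \* (fun x => complex.Re (g x))) \-
    ((fun x => complex.Im (f x)) \* (fun x => complex.Im (g x))).
    by apply/funext => x /=; case: (f x) => ? ?; case: (g x).
  by apply: measurable_funB; exact: measurable_funM.
- have -> : (fun x => complex.Im (f x * g x)) =
    ((fun x => complex.Re (f x)) \* (fun x => complex.Im (g x))) \+
    ((fun x => complex.Im (f x)) \* (fun x => complex.Re (g x))).
    by apply/funext => x /=; case: (f x) => ? ?; case: (g x).
  by apply: measurable_funD; exact: measurable_funM.
Qed.

Lemma cmeasurable_cst z : cmeasurable (fun=> z).
Proof. by split; exact: measurable_cst. Qed.

Lemma cmeasurable_sum (I : Type) (s : seq I) (F : I -> plane -> R[i]) :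
  (forall i, cmeasurable (F i)) -> cmeasurable (fun x => \sum_(i <- s) F i x).
Proof.
move=> mF; elim: s => [|i s IH].
  by under eq_fun do rewrite big_nil; exact: cmeasurable_cst.
by under eq_fun do rewrite big_cons; exact: cmeasurableD.
Qed.

Lemma measurable_sqr_cabs f : cmeasurable f ->
  measurable_fun [set: plane] (fun x => cabs (f x) ^+ 2).
Proof.
move=> [f1 f2]; under eq_fun do rewrite sqr_cabs.
by apply: measurable_funD; exact: measurable_funX.
Qed.

Lemma cintegrableD f g : cintegrable f -> cintegrable g ->
  cintegrable (fun x => f x + g x).
Proof.
have mD := measurable_unit_square; move=> [f1 f2] [g1 g2]; split.
- have := integrableD mD f1 g1; congr (_.-integrable _ _).
  by apply/funext => x /=; case: (f x) => ? ?; case: (g x).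
- have := integrableD mD f2 g2; congr (_.-integrable _ _).
  by apply/funext => x /=; case: (f x) => ? ?; case: (g x).
Qed.

Lemma CintegralD f g : cintegrable f -> cintegrable g ->
  Cintegral (fun x => f x + g x) = Cintegral f + Cintegral g.
Proof.
move=> [f1 f2] [g1 g2]; apply/eqP; rewrite eq_complex /=.
rewrite -!RintegralD//; try exact: measurable_unit_square.
by apply/andP; split; apply/eqP; apply: eq_Rintegral => x _;
  case: (f x) => ? ?; case: (g x).
Qed.

Lemma cintegrableZ z f : cintegrable f -> cintegrable (fun x => z * f x).
Proof.
have mD := measurable_unit_square; move=> [f1 f2]; split.
- have := integrableB mD (integrableZl mD (complex.Re z) f1)
    (integrableZl mD (complex.Im z) f2).
  congr (_.-integrable _ _).
  by apply/funext => x /=; case: z => ? ?; case: (f x).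
- have := integrableD mD (integrableZl mD (complex.Re z) f2)
    (integrableZl mD (complex.Im z) f1).
  congr (_.-integrable _ _).
  by apply/funext => x /=; case: z => ? ?; case: (f x).
Qed.

Lemma CintegralZ z f : cintegrable f ->
  Cintegral (fun x => z * f x) = z * Cintegral f.
Proof.
move=> [f1 f2]; have mD := measurable_unit_square.
apply/eqP; rewrite eq_complex /=; case: z => a b.
have i1 c : mu.-integrable D (EFin \o (fun x => c * complex.Re (f x))).
  exact: (integrableZl mD c f1).
have i2 c : mu.-integrable D (EFin \o (fun x => c * complex.Im (f x))).
  exact: (integrableZl mD c f2).
apply/andP; split; apply/eqP.
- transitivity (\int[mu]_(x in D) (a * complex.Re (f x) - b * complex.Im (f x))).
    by apply: eq_Rintegral => x _; case: (f x).
  by rewrite RintegralB// !RintegralZl.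
- transitivity (\int[mu]_(x in D) (a * complex.Im (f x) + b * complex.Re (f x))).
    by apply: eq_Rintegral => x _; case: (f x).
  by rewrite RintegralD// !RintegralZl.
Qed.

Lemma cintegrable0 : cintegrable (fun=> 0).
Proof. by split; exact: integrable0. Qed.

Lemma Cintegral0 : Cintegral (fun=> 0 : R[i]) = 0.
Proof. by rewrite /Cintegral /= /Rintegral integral0. Qed.

Lemma cintegrable_sum (I : Type) (s : seq I) (F : I -> plane -> R[i]) :
  (forall i, cintegrable (F i)) -> cintegrable (fun x => \sum_(i <- s) F i x).
Proof.
move=> iF; elim: s => [|i s IH].
  by under eq_fun do rewrite big_nil; exact: cintegrable0.
by under eq_fun do rewrite big_cons; exact: cintegrableD.
Qed.

Lemma Cintegral_sum (I : Type) (s : seq I) (F : I -> plane -> R[i]) :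
  (forall i, cintegrable (F i)) ->
  Cintegral (fun x => \sum_(i <- s) F i x) = \sum_(i <- s) Cintegral (F i).
Proof.
move=> iF; elim: s => [|i s IH].
  by under eq_fun do rewrite big_nil; rewrite big_nil Cintegral0.
under eq_fun do rewrite big_cons.
by rewrite big_cons CintegralD ?IH//; exact: cintegrable_sum.
Qed.

Definition character (n : Z2) (x : plane) : R[i] := cis (2 * pi * dotZ n x).

Lemma cmeasurable_character n : cmeasurable (character n).
Proof.
have mth : measurable_fun [set: plane] (fun x : plane => 2 * pi * dotZ n x).
  apply: measurable_funM; first exact: measurable_cst.
  rewrite /dotZ; apply: measurable_funD; apply: measurable_funM.
  - exact: measurable_cst.
  - exact: measurable_fst.
  - exact: measurable_cst.
  - exact: measurable_snd.
split.
- apply: (measurableT_comp (f := @cos R)) mth.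
  exact: (continuous_measurable_fun (@continuous_cos R)).
- apply: (measurableT_comp (f := @sin R)) mth.
  exact: (continuous_measurable_fun (@continuous_sin R)).
Qed.

Lemma cintegrable_character n : cintegrable (character n).
Proof.
have [m1 m2] := cmeasurable_character n; split.
- by apply: (bounded_integrable_square _ 1 m1) => x; exact: cos_max.
- by apply: (bounded_integrable_square _ 1 m2) => x; exact: sin_max.
Qed.

Lemma Cintegral_character (n : Z2) :
  Cintegral (character n) = (n == (0, 0))%:R.
Proof.
case: n => a b.
pose c (m : int) (x : R) := cos (2 * pi * (m%:~R * x)).
pose s (m : int) (x : R) := sin (2 * pi * (m%:~R * x)).
have mlin (m : int) : measurable_fun [set: measurableTypeR R]
    (fun x : R => 2 * pi * (m%:~R * x)).
  apply: measurable_funM; first exact: measurable_cst.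
  by apply: measurable_funM; [exact: measurable_cst|exact: measurable_id].
have mc m : measurable_fun [set: measurableTypeR R] (c m).
  apply: (measurableT_comp (f := @cos R)) (mlin m).
  exact: (continuous_measurable_fun (@continuous_cos R)).
have ms m : measurable_fun [set: measurableTypeR R] (s m).
  apply: (measurableT_comp (f := @sin R)) (mlin m).
  exact: (continuous_measurable_fun (@continuous_sin R)).
have c1 m x : `|c m x| <= 1 by exact: cos_max.
have s1 m x : `|s m x| <= 1 by exact: sin_max.
have iprod (h k : R -> R) : measurable_fun [set: measurableTypeR R] h ->
    measurable_fun [set: measurableTypeR R] k ->
    (forall x, `|h x| <= 1) -> (forall x, `|k x| <= 1) ->
    mu.-integrable D (EFin \o (fun x : plane => h x.1 * k x.2)).
  move=> mh mk h1 k1; apply: (bounded_integrable_square _ 1).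
    apply: measurable_funM.
      exact: (measurableT_comp mh measurable_fst).
    exact: (measurableT_comp mk measurable_snd).
  by move=> x; rewrite normrM mulr_ile1.
have mD := measurable_unit_square.
have split_phase (x : plane) : 2 * pi * dotZ (a, b) x =
    2 * pi * (a%:~R * x.1) + 2 * pi * (b%:~R * x.2) by rewrite -mulrDr.
apply/eqP; rewrite eq_complex; apply/andP; split; apply/eqP.
- transitivity (\int[mu]_(x in D) (c a x.1 * c b x.2 - s a x.1 * s b x.2)).
    by apply: eq_Rintegral => x _; rewrite /character split_phase /= cosD.
  rewrite RintegralB//; [|exact: iprod|exact: iprod].
  rewrite !(Rintegral_square_prod _ _ 1)// !Rintegral_cos_2pi !Rintegral_sin_2pi.
  rewrite mulr0 subr0 -natrM mulnb -[(a, b) == _]/((a == 0) && (b == 0)).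
  by case: (_ && _).
- transitivity (\int[mu]_(x in D) (s a x.1 * c b x.2 + c a x.1 * s b x.2)).
    by apply: eq_Rintegral => x _; rewrite /character split_phase /= sinD.
  rewrite RintegralD//; [|exact: iprod|exact: iprod].
  rewrite !(Rintegral_square_prod _ _ 1)// !Rintegral_cos_2pi !Rintegral_sin_2pi.
  by rewrite mulr0 mul0r addr0; case: (_ == _).
Qed.

Lemma characterJ (n m : Z2) (x : plane) :
  character m x * conjc (character n x) = character (m.1 - n.1, m.2 - n.2) x.
Proof.
rewrite /character -cisN -cisD /dotZ /= !intrB; congr cis; ring.
Qed.

End TorusFourier.

(** * Trigonometric polynomials and Fourier coefficients of [L^2] sums *)

Section TrigonometricPolynomials.
Context {R : realType}.

Local Notation plane := (measurableTypeR R * measurableTypeR R)%type.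
Local Notation mu := (@plane_measure R).
Local Notation D := (@unit_square R).

Definition sqnorm (f : plane -> R[i]) : \bar R :=
  (\int[mu]_(x in D) (cabs (f x) ^+ 2)%:E)%E.

Lemma sqnorm_ge0 f : (0 <= sqnorm f)%E.
Proof. by apply: integral_ge0 => x _; rewrite lee_fin sqr_ge0. Qed.

Lemma L2normE f : L2norm f = (sqnorm f `^ 2^-1)%E.
Proof. by []. Qed.

Lemma L2norm_sqrt f (r : R) : 0 <= r -> sqnorm f = r%:E ->
  L2norm f = (Num.sqrt r)%:E.
Proof. by move=> r0 h; rewrite L2normE h poweR_EFin powR12_sqrt. Qed.

Lemma sqnorm_lty f : (L2norm f < +oo)%E -> (sqnorm f < +oo)%E.
Proof. by rewrite L2normE; apply: lty_poweRy; rewrite invr_eq0 pnatr_eq0. Qed.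

Lemma sqnorm_le f (e : R) : 0 <= e -> (L2norm f <= e%:E)%E ->
  (sqnorm f <= (e ^+ 2)%:E)%E.
Proof.
move=> e0 fe; have : (sqnorm f < +oo)%E.
  by apply: sqnorm_lty; apply: le_lt_trans fe (ltry _).
move: fe (sqnorm_ge0 f); rewrite L2normE; case: (sqnorm f) => [r| |]//.
rewrite poweR_EFin !lee_fin => re r0 _.
have -> : r = (r `^ 2^-1) ^+ 2.
  by rewrite -powR_mulrn ?powR_ge0// -powRrM mulVf ?powRr1// pnatr_eq0.
by rewrite ler_sqr ?nnegrE ?powR_ge0.
Qed.

Lemma eq_sqnorm f g : (forall x, cabs (f x) = cabs (g x)) ->
  sqnorm f = sqnorm g.
Proof. by move=> fg; apply: eq_integral => x _; rewrite fg. Qed.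

Lemma normr_Re_le (z : R[i]) : `|complex.Re z| <= cabs z.
Proof. by rewrite cabsE -sqrtr_sqr ler_wsqrtr// lerDl sqr_ge0. Qed.

Lemma normr_Im_le (z : R[i]) : `|complex.Im z| <= cabs z.
Proof. by rewrite cabsE -sqrtr_sqr ler_wsqrtr// lerDr sqr_ge0. Qed.

Lemma cabs_le_ReIm (z : R[i]) : cabs z <= `|complex.Re z| + `|complex.Im z|.
Proof.
rewrite -ler_sqr ?nnegrE ?cabs_ge0 ?addr_ge0// sqr_cabs sqrrD !real_normK ?num_real//.
by rewrite -addrA lerD2l lerDr mulrn_wge0// mulr_ge0.
Qed.

Lemma integrable_sqr_cabs f : cmeasurable f -> (sqnorm f < +oo)%E ->
  mu.-integrable D (EFin \o (fun x => cabs (f x) ^+ 2)).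
Proof.
move=> mf fy; apply/integrableP; split.
  by apply/measurable_EFinP; apply: measurable_funTS; exact: measurable_sqr_cabs.
apply: le_lt_trans fy; rewrite le_eqVlt; apply/orP; left; apply/eqP.
by apply: eq_integral => x _ /=; rewrite ger0_norm// sqr_ge0.
Qed.

(** Stands in for Cauchy-Schwarz: integrated over the unit square, of mass 1, it bounds the integral
    of [|f|] by [2e] when the [L^2] norm is at most [e]. *)
Lemma cabs_le_shift (e c : R) : 0 < e -> 0 <= c -> c <= e + c ^+ 2 / e.
Proof.
move=> e0 c0; have [ce|ec] := leP c e.
  by apply: ler_wpDr => //; rewrite divr_ge0 ?sqr_ge0// ltW.
by apply: ler_wpDl; [exact: ltW|rewrite ler_pdivlMr// expr2 ler_wpM2l// ltW].
Qed.

Lemma integrable_shift f (e : R) : cmeasurable f -> (sqnorm f < +oo)%E ->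
  mu.-integrable D (EFin \o (fun x => e + cabs (f x) ^+ 2 / e)).
Proof.
move=> mf fy; have mD := @measurable_unit_square R.
have ic : mu.-integrable D (EFin \o (fun=> e)).
  by apply: (bounded_integrable_square _ `|e|) => //; exact: measurable_cst.
have := integrableD mD ic (integrableZr mD e^-1 (integrable_sqr_cabs f mf fy)).
by congr (_.-integrable _ _); apply/funext => x /=.
Qed.

Lemma cintegrable_of f : cmeasurable f -> (sqnorm f < +oo)%E -> cintegrable f.
Proof.
move=> mf fy; have mD := @measurable_unit_square R.
have i1 := integrable_shift f 1 mf fy.
split; apply: (le_integrable mD _ _ i1).
- by apply/measurable_EFinP; apply: measurable_funTS; exact: mf.1.
- move=> x _ /=; rewrite lee_fin (le_trans (normr_Re_le _))//.
  rewrite (le_trans _ (ler_norm _))//; exact: cabs_le_shift (cabs_ge0 _).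
- by apply/measurable_EFinP; apply: measurable_funTS; exact: mf.2.
- move=> x _ /=; rewrite lee_fin (le_trans (normr_Im_le _))//.
  rewrite (le_trans _ (ler_norm _))//; exact: cabs_le_shift (cabs_ge0 _).
Qed.

Lemma Rintegral_le_of_sqnorm f (g : plane -> R) (e : R) : 0 < e ->
  cmeasurable f -> (sqnorm f <= (e ^+ 2)%:E)%E ->
  mu.-integrable D (EFin \o g) -> (forall x, `|g x| <= cabs (f x)) ->
  `|\int[mu]_(x in D) g x| <= 2 * e.
Proof.
move=> e0 mf fe ig gf; have mD := @measurable_unit_square R.
have fy : (sqnorm f < +oo)%E by exact: le_lt_trans fe (ltry _).
apply: (le_trans (le_normr_Rintegral mD ig)).
have is2 := integrable_sqr_cabs f mf fy.
have ic : mu.-integrable D (EFin \o (fun=> e)).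
  by apply: (bounded_integrable_square _ `|e|) => //; exact: measurable_cst.
have iz : mu.-integrable D (EFin \o (fun x => cabs (f x) ^+ 2 / e)).
  exact: (integrableZr mD e^-1 is2).
apply: (@le_trans _ _ (\int[mu]_(x in D) (e + cabs (f x) ^+ 2 / e))).
  apply: le_Rintegral => //.
  - exact: (integrable_abse ig).
  - exact: integrable_shift.
  - by move=> x _; rewrite (le_trans (gf x))// cabs_le_shift ?cabs_ge0.
rewrite RintegralD// RintegralZr// Rintegral_cst//.
rewrite [X in fine X]plane_measure_unit_square /= mulr1.
have -> : 2 * e = e + e by ring.
rewrite lerD2l ler_pdivrMr// -expr2 -lee_fin.
by rewrite /Rintegral fineK// (integrable_fin_num mD is2).
Qed.

Lemma cabs_Cintegral_le f (e : R) : 0 < e -> cmeasurable f ->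
  (sqnorm f <= (e ^+ 2)%:E)%E -> cabs (Cintegral f) <= 4 * e.
Proof.
move=> e0 mf fe.
have fy : (sqnorm f < +oo)%E by exact: le_lt_trans fe (ltry _).
have [i1 i2] := cintegrable_of f mf fy.
apply: (le_trans (cabs_le_ReIm _)) => /=.
have -> : 4 * e = 2 * e + 2 * e by ring.
apply: lerD; apply: (Rintegral_le_of_sqnorm f) => // x.
  exact: normr_Re_le.
exact: normr_Im_le.
Qed.

Definition trigpoly (s : seq Z2) (a : Z2 -> R[i]) (x : plane) : R[i] :=
  \sum_(n <- s) a n * character n x.

Lemma cmeasurable_trigpoly s a : cmeasurable (trigpoly s a).
Proof.
apply: cmeasurable_sum => n; apply: cmeasurableM.
  exact: cmeasurable_cst.
exact: cmeasurable_character.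
Qed.

Lemma sqnorm_trigpoly s a : uniq s ->
  sqnorm (trigpoly s a) = (\sum_(n <- s) cabs (a n) ^+ 2)%:E.
Proof.
move=> us; have mD := @measurable_unit_square R.
pose H x := \sum_(m <- s) \sum_(n <- s) (a m * conjc (a n)) *
  character (m.1 - n.1, m.2 - n.2) x.
have HE x : H x = Complex (cabs (trigpoly s a x) ^+ 2) 0.
  rewrite -mulcJ /trigpoly (rmorph_sum (@conjc R)) big_distrlr.
  apply: eq_bigr => m _; apply: eq_bigr => n _.
  rewrite (rmorphM (@conjc R)) -characterJ.
  set e1 := character _ _; set e2 := conjc (character _ _).
  change (a m * conjc (a n) * (e1 * e2) = (a m * e1) * (conjc (a n) * e2)).
  by ring.
have iterm (m n : Z2) : cintegrable (fun x => (a m * conjc (a n)) *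
    character (m.1 - n.1, m.2 - n.2) x).
  by apply: cintegrableZ; exact: cintegrable_character.
have iH : cintegrable H.
  by apply: cintegrable_sum => m; exact: cintegrable_sum.
have CH : Cintegral H = \sum_(m <- s) Complex (cabs (a m) ^+ 2) 0.
  rewrite /H Cintegral_sum; last by move=> m; exact: cintegrable_sum.
  rewrite big_seq [RHS]big_seq; apply: eq_bigr => m ms.
  rewrite Cintegral_sum// (bigD1_seq m)//= big1 ?addr0.
    rewrite CintegralZ ?Cintegral_character; last exact: cintegrable_character.
    by rewrite !subrr eqxx mulr1 mulcJ.
  move=> n nm; rewrite CintegralZ ?Cintegral_character; last first.
    exact: cintegrable_character.
  rewrite (_ : (_ == _) = false) ?mulr0//.
  apply/negbTE; apply: contraNN nm => /eqP[/eqP + /eqP].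
  by rewrite !subr_eq0 => /eqP e1 /eqP e2; case: m n e1 e2 {ms} => ? ? [? ?] /= -> ->.
have -> : sqnorm (trigpoly s a) = (\int[mu]_(x in D) (complex.Re (H x))%:E)%E.
  by apply: eq_integral => x _; rewrite HE.
rewrite -[LHS]fineK; last exact: (integrable_fin_num mD iH.1).
congr (_%:E); transitivity (complex.Re (Cintegral H)); first by [].
rewrite CH; elim: (s) => [|m s' IH]; first by rewrite !big_nil.
by rewrite !big_cons -IH; case: (\sum_(_ <- _) _).
Qed.

Lemma L2norm_trigpoly s a : uniq s ->
  L2norm (trigpoly s a) = (Num.sqrt (\sum_(n <- s) cabs (a n) ^+ 2))%:E.
Proof.
move=> us; apply: L2norm_sqrt; last exact: sqnorm_trigpoly.
by apply: sumr_ge0 => n _; exact: sqr_ge0.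
Qed.

Lemma trigpoly_L2 s a : uniq s -> L2 (trigpoly s a).
Proof.
move=> us; have [m1 m2] := cmeasurable_trigpoly s a; split => //.
- move=> x k; apply: eq_bigr => n _; congr (_ * _).
  rewrite /character (_ : 2 * pi * dotZ n (x.1 + k.1%:~R, x.2 + k.2%:~R) =
    2 * pi * dotZ n x + 2 * pi * (n.1 * k.1 + n.2 * k.2)%:~R).
    by rewrite cisD cis2pi mulr1.
  by rewrite /dotZ /= intrD !intrM; ring.
- by rewrite L2norm_trigpoly// ltry.
Qed.

Lemma cmeasurable_L2 (f : plane -> R[i]) : L2 f -> cmeasurable f.
Proof. by case. Qed.

Lemma totally_small (F : {fset Z2} -> \bar R) (e : R) : 0 < e ->
  F @ totally --> 0%E ->
  exists A0 : {fset Z2}, forall A : {fset Z2}, (A0 `<=` A)%fset -> (F A < e%:E)%E.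
Proof.
move=> e0 Fcvg.
have : nbhs (0%E : \bar R) [set y | (y < e%:E)%E].
  by apply: open_ereal_lt'; rewrite lte_fin.
by move=> /Fcvg[A0 _ A0F]; exists A0 => A A0A; exact: A0F.
Qed.

Lemma character_conj_mul_sum (n : Z2) (s : seq Z2) (c : Z2 -> R[i])
    (u : plane -> R[i]) x :
  conjc (character n x) * (u x - trigpoly s c x) =
  conjc (character n x) * u x +
  \sum_(m <- s) - c m * character (m.1 - n.1, m.2 - n.2) x.
Proof.
rewrite mulrBr; congr (_ + _); rewrite /trigpoly mulr_sumr -sumrN.
apply: eq_bigr => m _; rewrite -characterJ.
set e1 := character m x; set e2 := conjc (character n x).
change (- (e2 * (c m * e1)) = - c m * (e1 * e2)); ring.
Qed.

Lemma cmeasurable_conj_character n :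
  cmeasurable (fun x : plane => conjc (character n x)).
Proof.
have -> : (fun x : plane => conjc (character n x)) = character (- n.1, - n.2).
  apply/funext => x; rewrite /character -cisN; congr cis.
  by rewrite /dotZ /= !intrN; ring.
exact: cmeasurable_character.
Qed.

Lemma fourierE (f : plane -> R[i]) n :
  fourier f n = Cintegral (fun x => conjc (character n x) * f x).
Proof.
by rewrite /fourier; congr Cintegral; apply/funext => x; rewrite cisN.
Qed.

(** Pairing with a character is continuous in [L^2], and by orthogonality a partial sum containing
    [n] has [n]-th coefficient exactly [c n]. *)
Lemma fourier_L2sum (c : Z2 -> R[i]) u :
  is_L2sum (fun n x => c n * cis (2 * pi * dotZ n x)) u ->
  forall n, fourier u n = c n.
Proof.
move=> [uL2 ucvg] n.
have mu_u := cmeasurable_L2 _ uL2.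
have uy : (sqnorm u < +oo)%E by case: uL2 => _ _ _ /sqnorm_lty.
suff small (e : R) : 0 < e -> cabs (fourier u n - c n) <= 4 * e.
  apply/eqP; rewrite -subr_eq0 -cabs_eq0 eq_le cabs_ge0 andbT.
  apply/ler_addgt0Pr => e e0; rewrite add0r.
  have -> : e = 4 * (e / 4) by field.
  by apply: small; rewrite divr_gt0.
move=> e0; have [A0 A0P] := totally_small _ e e0 ucvg.
pose A := (n |` A0)%fset.
have {}A0P : (L2norm (fun x => (u x - trigpoly A c x)%R) <= e%:E)%E.
  by apply: ltW; apply: A0P; exact: fsubsetU1.
have uA : uniq A by exact: fset_uniq.
have nA : n \in (A : seq Z2) by exact: fset1U1.
have mv : cmeasurable (fun x => u x - trigpoly A c x).
  have -> : (fun x => u x - trigpoly A c x) = (fun x => u x + -1 * trigpoly A c x).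
    by apply/funext => x; rewrite mulN1r.
  apply: cmeasurableD => //; apply: cmeasurableM; first exact: cmeasurable_cst.
  exact: cmeasurable_trigpoly.
have mcv : cmeasurable (fun x => conjc (character n x) * (u x - trigpoly A c x)).
  by apply: cmeasurableM => //; exact: cmeasurable_conj_character.
have cabsconj (f : plane -> R[i]) x : cabs (conjc (character n x) * f x) = cabs (f x).
  by rewrite cabsM cabsJ cabs_cis mul1r.
have mcu : cmeasurable (fun x => conjc (character n x) * u x).
  by apply: cmeasurableM => //; exact: cmeasurable_conj_character.
have icu : cintegrable (fun x => conjc (character n x) * u x).
  apply: cintegrable_of => //.
  by rewrite (eq_sqnorm _ u)// => x; exact: cabsconj.
have iterm (m : Z2) : cintegrable (fun x => - c m *
    character (m.1 - n.1, m.2 - n.2) x).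
  by apply: cintegrableZ; exact: cintegrable_character.
have <- : Cintegral (fun x => conjc (character n x) * (u x - trigpoly A c x)) =
    fourier u n - c n.
  under eq_fun do rewrite character_conj_mul_sum.
  rewrite CintegralD//; last exact: cintegrable_sum.
  rewrite -fourierE; congr (_ + _).
  rewrite Cintegral_sum// (bigD1_seq n)//= big1 ?addr0.
    rewrite CintegralZ ?Cintegral_character; last exact: cintegrable_character.
    by rewrite !subrr eqxx mulr1.
  move=> m mn; rewrite CintegralZ ?Cintegral_character; last first.
    exact: cintegrable_character.
  rewrite (_ : (_ == _) = false) ?mulr0//.
  apply/negbTE; apply: contraNN mn => /eqP[/eqP + /eqP].
  by rewrite !subr_eq0 => /eqP e1 /eqP e2; case: m n e1 e2 {nA A mv mcv cabsconj mcu icu iterm uA A0P} => ? ? [? ?] /= -> ->.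
apply: cabs_Cintegral_le => //.
rewrite (eq_sqnorm _ (fun x => u x - trigpoly A c x)); last first.
  by move=> x; exact: (cabsconj (fun x => u x - trigpoly A c x)).
by apply: sqnorm_le => //; exact: ltW.
Qed.

Lemma sum_supported (s B : seq Z2) (F : Z2 -> R[i]) : uniq s -> uniq B ->
  {subset s <= B} -> (forall n, n \notin s -> F n = 0) ->
  \sum_(n <- B) F n = \sum_(n <- s) F n.
Proof.
move=> us uB sB F0; rewrite (bigID (mem s)) /= [X in _ + X]big1// addr0.
rewrite -big_filter; apply: perm_big; apply: uniq_perm => //.
  exact: filter_uniq.
move=> n; rewrite mem_filter; case: (boolP (n \in s)) => //= /sB ->.
by [].
Qed.

Lemma finite_is_L2sum (s : seq Z2) (c : Z2 -> R[i]) : uniq s ->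
  (forall n, n \notin s -> c n = 0) ->
  is_L2sum (fun n x => c n * cis (2 * pi * dotZ n x)) (trigpoly s c).
Proof.
move=> us c0; split; first exact: trigpoly_L2.
apply: cvg_near_cst.
  exact: (@filter_filter _ _ totally_filter).
rewrite nearE; exists [fset n in s]%fset => // A /= sA.
apply/eqP; rewrite (_ : (fun x => _) = trigpoly [::] c).
  by rewrite L2norm_trigpoly// big_nil sqrtr0.
apply/funext => x; rewrite /trigpoly big_nil.
rewrite (sum_supported s A) ?subrr//.
- exact: fset_uniq.
- by move=> n ns; apply: (fsubsetP sA); rewrite inE.
- by move=> n ns; rewrite c0// mul0r.
Qed.

(** An [L^2] limit is pinned down only up to a null set. All partial sums containing [s] equal the
    polynomial, so its distance to [u] is below every [e]. *)
Lemma finite_L2sum_ae (s : seq Z2) (c : Z2 -> R[i]) u : uniq s ->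
  (forall n, n \notin s -> c n = 0) ->
  is_L2sum (fun n x => c n * cis (2 * pi * dotZ n x)) u ->
  {ae mu, forall x, D x -> u x = trigpoly s c x}.
Proof.
move=> us c0 [uL2 ucvg]; have mD := @measurable_unit_square R.
have mu_u := cmeasurable_L2 _ uL2.
pose v x := u x - trigpoly s c x.
have mv : cmeasurable v.
  have -> : v = (fun x => u x + -1 * trigpoly s c x).
    by apply/funext => x; rewrite mulN1r.
  apply: cmeasurableD => //; apply: cmeasurableM; first exact: cmeasurable_cst.
  exact: cmeasurable_trigpoly.
have small (e : R) : 0 < e -> (L2norm v <= e%:E)%E.
  move=> e0; have [A0 A0P] := totally_small _ e e0 ucvg.
  have := A0P ([fset n in s] `|` A0)%fset (fsubsetUr _ _).
  rewrite (_ : (fun x => _) = v); first exact: ltW.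
  apply/funext => x; rewrite /v /trigpoly; congr (_ - _).
  apply: sum_supported => //.
  - exact: fset_uniq.
  - by move=> n ns; rewrite !inE ns.
  - by move=> n ns; rewrite c0// mul0r.
have v0 : sqnorm v = 0%E.
  apply/eqP; rewrite eq_le sqnorm_ge0 andbT.
  apply/lee_addgt0Pr => e e0; rewrite add0e.
  have := sqnorm_le v (Num.sqrt e) (sqrtr_ge0 _).
  by rewrite sqr_sqrtr ?(ltW e0)//; apply; apply: small; rewrite sqrtr_gt0.
have mEv : measurable_fun D (fun x => (cabs (v x) ^+ 2)%:E).
  by apply/measurable_EFinP; apply: measurable_funTS; exact: measurable_sqr_cabs.
have : (\int[mu]_(x in D) `|(cabs (v x) ^+ 2)%:E|)%E = 0%E.
  rewrite -v0; apply: eq_integral => x _.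
  by rewrite gee0_abs// lee_fin sqr_ge0.
move/(ae_eq_integral_abs mu mD mEv).
apply: filterS => x h Dx; move: (h Dx) => /= -[] /eqP.
by rewrite sqrf_eq0 cabs_eq0 subr_eq0 => /eqP.
Qed.

End TrigonometricPolynomials.

(** * Frequency projections of the evolution and the product at a fixed time *)

Section FrequencyProjections.
Context {R : realType}.

Local Notation plane := (measurableTypeR R * measurableTypeR R)%type.
Local Notation mu := (@plane_measure R).
Local Notation D := (@unit_square R).

Local Notation ae_filter := (ae_filter_ringOfSetsType mu).

Definition enumerates (s : seq Z2) (S : set Z2) : Prop :=
  uniq s /\ forall n, n \in s <-> S n.

(** With finitely many frequencies the partial sums are eventually constant, so a limit exists and
    [xget] does not fall back on its default. *)
Lemma fourier_proj_trigpoly (S : set Z2) (s : seq Z2) (f : plane -> R[i]) :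
  enumerates s S -> cmeasurable (fourier_proj S f) /\
  {ae mu, forall x, D x -> fourier_proj S f x = trigpoly s (fourier f) x}.
Proof.
move=> [us sS]; pose c n := Complex (\1_S n) 0 * fourier f n.
have c0 n : n \notin s -> c n = 0.
  move=> ns; rewrite /c indicE (_ : (n \in S) = false) ?mul0r//.
  by apply/negbTE; apply: contra ns => /set_mem /sS.
have cE n : n \in s -> c n = fourier f n.
  by move=> /sS nS; rewrite /c indicE mem_set// mul1r.
have h : is_L2sum (fun n x => c n * cis (2 * pi * dotZ n x)) (fourier_proj S f).
  by apply: xgetPex; exists (trigpoly s c); exact: finite_is_L2sum.
split; first exact: cmeasurable_L2 h.1.
have := finite_L2sum_ae s c _ us c0 h; apply: (@filterS _ _ ae_filter) => x hx Dx.
by rewrite (hx Dx); apply: eq_big_seq => n /cE ->.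
Qed.

Lemma L2norm_fourier_proj (S : set Z2) (s : seq Z2) (f : plane -> R[i]) :
  enumerates s S ->
  L2norm (fourier_proj S f) =
  (Num.sqrt (\sum_(n <- s) cabs (fourier f n) ^+ 2))%:E.
Proof.
move=> sS; have [mf aef] := fourier_proj_trigpoly S s f sS.
rewrite -L2norm_trigpoly; last exact: sS.1.
rewrite !L2normE; congr (_ `^ _)%E.
apply: ge0_ae_eq_integral.
- exact: measurable_unit_square.
- by apply/measurable_EFinP; apply: measurable_funTS; exact: measurable_sqr_cabs.
- apply/measurable_EFinP; apply: measurable_funTS; apply: measurable_sqr_cabs.
  exact: cmeasurable_trigpoly.
- by move=> x _; rewrite lee_fin sqr_ge0.
- by move=> x _; rewrite lee_fin sqr_ge0.
- by move: aef; apply: (@filterS _ _ ae_filter) => x hx Dx; rewrite hx.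
Qed.

(* When the sum defining the evolution diverges, [schrodinger] is the zero
   function; this only decreases the left-hand side. *)
Lemma fourier_schrodinger (a1 a2 t : R) (f : plane -> R[i]) :
  exists eps : bool, forall n, fourier (schrodinger a1 a2 t f) n =
    Complex eps%:R 0 * (fourier f n * cis (2 * pi * (Qform a1 a2 n * t))).
Proof.
set g := fun (n : Z2) (x : plane) =>
  fourier f n * cis (2 * pi * (dotZ n x + Qform a1 a2 n * t)).
have gE : g = fun n x => fourier f n * cis (2 * pi * (Qform a1 a2 n * t))
    * cis (2 * pi * dotZ n x).
  apply/funext => n; apply/funext => x.
  by rewrite /g mulrDr cisD mulrCA [RHS]mulrC.
have [[u hu]|noL2] := pselect (exists u, is_L2sum g u).
  exists true => n; rewrite -[Complex _ _]/(1 : R[i]) mul1r.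
  apply: (fourier_L2sum
    (fun n => fourier f n * cis (2 * pi * (Qform a1 a2 n * t)))).
  rewrite -gE; apply: (@xgetPex _ _ [set u | is_L2sum g u]).
  by exists u.
exists false => n; rewrite -[Complex _ _]/(0 : R[i]) mul0r.
rewrite /schrodinger /L2sum xgetPN; last by move=> u hu; apply: noL2; exists u.
rewrite fourierE; under eq_fun do rewrite mulr0.
exact: Cintegral0.
Qed.

Lemma trigpoly_schrodinger_le (a1 a2 t : R) (f : plane -> R[i]) (s : seq Z2) x :
  cabs (trigpoly s (fourier (schrodinger a1 a2 t f)) x) <=
  cabs (\sum_(n <- s) fourier f n * cis (phase a1 a2 n x t)).
Proof.
have [eps epsE] := fourier_schrodinger a1 a2 t f.
have -> : trigpoly s (fourier (schrodinger a1 a2 t f)) x = Complex eps%:R 0 *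
    (\sum_(n <- s) fourier f n * cis (phase a1 a2 n x t)).
  rewrite /trigpoly mulr_sumr; apply: eq_bigr => n _.
  have -> : phase a1 a2 n x t =
      2 * pi * dotZ n x + 2 * pi * (Qform a1 a2 n * t) by rewrite /phase; ring.
  by rewrite epsE /character cisD; ring.
rewrite cabsM cabs_real; case: eps {epsE} => /=; rewrite ?normr1 ?mul1r//.
by rewrite normr0 mul0r cabs_ge0.
Qed.

Lemma sum_sqr_schrodinger_le (a1 a2 t : R) (f : plane -> R[i]) (s : seq Z2) :
  \sum_(n <- s) cabs (fourier (schrodinger a1 a2 t f) n) ^+ 2 <=
  \sum_(n <- s) cabs (fourier f n) ^+ 2.
Proof.
have [eps epsE] := fourier_schrodinger a1 a2 t f.
apply: ler_sum => n _; rewrite epsE !cabsM cabs_cis mulr1 cabs_real exprMn.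
case: eps {epsE} => /=; first by rewrite normr1 expr1n mul1r.
by rewrite normr0 expr0n mul0r sqr_ge0.
Qed.

(** Two factors leave the integral through their uniform bounds; Parseval handles the first, whose
    coefficients the evolution multiplies by numbers of modulus at most 1. *)
Lemma L2norm_product_le (a1 a2 t : R) (S1 S2 S3 : set Z2) (s1 s2 s3 : seq Z2)
    (f1 f2 f3 : plane -> R[i]) (b2 b3 : R) :
  enumerates s1 S1 -> enumerates s2 S2 -> enumerates s3 S3 ->
  0 <= b2 -> 0 <= b3 ->
  (forall x, cabs (\sum_(n <- s2) fourier f2 n * cis (phase a1 a2 n x t)) <= b2) ->
  (forall x, cabs (\sum_(n <- s3) fourier f3 n * cis (phase a1 a2 n x t)) <= b3) ->
  (L2norm (fun x => (fourier_proj S1 (schrodinger a1 a2 t f1) x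
     * fourier_proj S2 (schrodinger a1 a2 t f2) x
     * fourier_proj S3 (schrodinger a1 a2 t f3) x)%R)
   <= (Num.sqrt (\sum_(n <- s1) cabs (fourier f1 n) ^+ 2) * (b2 * b3))%:E)%E.
Proof.
move=> e1 e2 e3 b20 b30 hb2 hb3.
have [m1 ae1] := fourier_proj_trigpoly S1 s1 (schrodinger a1 a2 t f1) e1.
have [m2 ae2] := fourier_proj_trigpoly S2 s2 (schrodinger a1 a2 t f2) e2.
have [m3 ae3] := fourier_proj_trigpoly S3 s3 (schrodinger a1 a2 t f3) e3.
set u1 := fourier_proj S1 _ in m1 ae1 *.
set u2 := fourier_proj S2 _ in m2 ae2 *.
set u3 := fourier_proj S3 _ in m3 ae3 *.
set g1 := trigpoly s1 _ in ae1.
set B1 := \sum_(n <- s1) cabs (fourier f1 n) ^+ 2.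
have B10 : 0 <= B1 by apply: sumr_ge0 => n _; exact: sqr_ge0.
have mD := @measurable_unit_square R.
have mg1 : measurable_fun D (fun x : plane => (cabs (g1 x) ^+ 2)%:E).
  apply/measurable_EFinP; apply: measurable_funTS; apply: measurable_sqr_cabs.
  exact: cmeasurable_trigpoly.
have key : (sqnorm (fun x => (u1 x * u2 x * u3 x)%R)
    <= (B1 * (b2 * b3) ^+ 2)%:E)%E.
  apply: (@le_trans _ _ (\int[mu]_(x in D)
      (((b2 * b3) ^+ 2)%:E * (cabs (g1 x) ^+ 2)%:E))%E).
    apply: ae_ge0_le_integral => //.
    - by move=> x _; rewrite lee_fin sqr_ge0.
    - apply/measurable_EFinP; apply: measurable_funTS; apply: measurable_sqr_cabs.
      by apply: cmeasurableM => //; exact: cmeasurableM.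
    - by move=> x _; rewrite -EFinM lee_fin mulr_ge0 ?sqr_ge0.
    - exact: measurable_funeM.
    - move: ae1 ae2 ae3; apply: (@filterS3 _ _ ae_filter) => x h1 h2 h3 Dx.
      rewrite -EFinM lee_fin (h1 Dx) (h2 Dx) (h3 Dx) -/g1 -mulrA !cabsM exprMn.
      rewrite mulrC ler_wpM2r ?sqr_ge0//.
      rewrite ler_sqr ?nnegrE ?mulr_ge0 ?cabs_ge0//.
      apply: ler_pM; rewrite ?cabs_ge0//.
        exact: le_trans (trigpoly_schrodinger_le _ _ _ _ _ _) (hb2 x).
      exact: le_trans (trigpoly_schrodinger_le _ _ _ _ _ _) (hb3 x).
  rewrite ge0_integralZl_EFin ?sqr_ge0//; last first.
    by move=> x _; rewrite lee_fin sqr_ge0.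
  rewrite -/(sqnorm g1) sqnorm_trigpoly; last exact: e1.1.
  rewrite -EFinM lee_fin mulrC ler_wpM2r ?sqr_ge0//.
  exact: sum_sqr_schrodinger_le.
have -> : (Num.sqrt B1 * (b2 * b3))%:E = ((B1 * (b2 * b3) ^+ 2)%:E `^ 2^-1)%E.
  rewrite poweR_EFin powR12_sqrt ?mulr_ge0 ?sqr_ge0// sqrtrM// sqrtr_sqr.
  by rewrite ger0_norm// mulr_ge0.
rewrite L2normE; apply: gt0_ler_poweR => //.
- by rewrite in_itv /= sqnorm_ge0 leey.
- by rewrite in_itv /= lee_fin leey andbT mulr_ge0// sqr_ge0.
Qed.

End FrequencyProjections.

(** * Bounding a time integral by suprema over bins *)

Section TimeIntegral.
Context {R : realType}.
Local Notation leb := (@lebesgue_measure R).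

(* No measurability is required, since the integral of a nonnegative function
   is the supremum over the simple functions below it. *)
Lemma ge0_le_integral_setT (f g : R -> \bar R) :
  (forall x, (0 <= f x)%E) -> (forall x, (f x <= g x)%E) ->
  (\int[leb]_x f x <= \int[leb]_x g x)%E.
Proof.
move=> f0 fg; rewrite !ge0_integralTE// => [|x]; last exact: le_trans (fg x).
apply: ereal_sup_le => _ [h hf <-]; exists h => // x.
exact: le_trans (hf x) (fg x).
Qed.

Definition time_bin (J j : nat) : set (measurableTypeR R) :=
  `[j%:R / J%:R, j.+1%:R / J%:R].

Lemma lebesgue_time_bin (J j : nat) : (0 < J)%N ->
  leb (time_bin J j) = (J%:R^-1)%:E.
Proof.
move=> J0; have J0' : (0 : R) < J%:R by rewrite ltr0n.
rewrite /time_bin lebesgue_measure_itv/= lte_fin ltr_pM2r ?invr_gt0// ltr_nat ltnSn.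
by rewrite -EFinB -mulrBl -natr1 addrAC subrr add0r mul1r.
Qed.

Lemma integral_le_bins (J : nat) (tau : set R) (f : R -> \bar R) (b : nat -> R) :
  (0 < J)%N -> tau `<=` `[0, 1] -> (forall t, (0 <= f t)%E) ->
  (forall j, 0 <= b j) ->
  (forall j t, (j < J)%N -> j%:R <= J%:R * t <= j%:R + 1 ->
     (f t <= (b j)%:E)%E) ->
  (\int[leb]_(t in tau) f t <= ((\sum_(j < J) b j) / J%:R)%:E)%E.
Proof.
move=> J0 tau01 f0 b0 fb; have J0' : (0 : R) < J%:R by rewrite ltr0n.
have mI j : measurable (time_bin J j) by exact: measurable_itv.
rewrite integral_mkcond.
apply: (@le_trans _ _ (\int[leb]_t
    (\sum_(j < J) (b j)%:E * (\1_(time_bin J j) t)%:E)))%E.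
  have term0 (j : 'I_J) t : (0 <= (b j)%:E * (\1_(time_bin J j) t)%:E)%E.
    by rewrite -EFinM lee_fin mulr_ge0// indicE.
  apply: ge0_le_integral_setT => t.
    by rewrite patchE; case: ifP.
  rewrite patchE; case: ifPn => [|_]; last by apply: sume_ge0 => j _.
  move=> /set_mem /tau01; rewrite /= in_itv /= => /andP[t0 t1].
  (* The cap at [J - 1] puts [t = 1] into the last bin. *)
  pose j := minn (Num.truncn (J%:R * t)) J.-1.
  have Jt0 : 0 <= J%:R * t by rewrite mulr_ge0// ltW.
  have /andP[h1 h2] := truncn_itv Jt0.
  have jJ : (j < J)%N by rewrite /j; lia.
  have hj : j%:R <= J%:R * t <= j%:R + 1.
    apply/andP; split.
      by apply: le_trans h1; rewrite ler_nat /j geq_minl.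
    rewrite /j /minn; case: ifP => _; first by rewrite natr1 ltW.
    by rewrite natr1 prednK// ler_piMr// ltW.
  apply: (le_trans (fb j t jJ hj)).
  rewrite (bigD1 (Ordinal jJ))//= indicE mem_set; last first.
    move: hj => /andP[h3 h4]; rewrite /time_bin /= in_itv /=.
    by rewrite ler_pdivrMr// ler_pdivlMr// mulrC h3 -natr1 h4.
  by rewrite mule1 leeDl// sume_ge0.
rewrite ge0_integral_sum//; last first.
- by move=> j t _; rewrite -EFinM lee_fin mulr_ge0// indicE.
- move=> j; apply: measurable_funeM; apply/measurable_EFinP.
  exact: measurable_indic.
rewrite mulr_suml -sumEFin; apply: lee_sum => j _.
rewrite ge0_integralZl_EFin//; last by apply/measurable_EFinP; exact: measurable_indic.
by rewrite integral_indic// setIT EFinM -(lebesgue_time_bin J j J0).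
Qed.

End TimeIntegral.

(** * Rotated boxes as finite subsets of translated squares *)

Section Boxes.
Context {R : realType}.

(* Orthogonality makes this independent of the rotation. *)
Lemma rotated_box_diam (M : R) (S : set Z2) (n m : Z2) :
  rotated_boxes M S -> S n -> S m ->
  `|(n.1 - m.1)%:~R| <= 3 * M /\ `|(n.2 - m.2)%:~R| <= 3 * M :> R.
Proof.
move=> [z [W [WW hW]]] Sn Sm.
have WtW : W^T *m W = 1%:M by exact: mulmx1C.
pose d : 'cV[R]_2 := colZ R n - colZ R m.
have M0 : 0 <= M by have /andP[h1 h2] := hW n Sn ord0; lra.
have Wd i : `|(W *m d) i 0| <= 2 * M.
  have /andP[h1 h2] := hW n Sn i; have /andP[h3 h4] := hW m Sm i.
  have -> : (W *m d) i 0 = (W *m colZ R n + colZ R z) i 0 - (W *m colZ R m + colZ R z) i 0.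
    by rewrite /d mulmxBr !mxE; ring.
  by rewrite ler_norml; apply/andP; split; lra.
have isom : (d^T *m d) 0 0 = ((W *m d)^T *m (W *m d)) 0 0.
  by rewrite trmx_mul mulmxA -(mulmxA d^T) WtW mulmx1.
have sqE (v : 'cV[R]_2) : (v^T *m v) 0 0 = v ord0 0 ^+ 2 + v ord_max 0 ^+ 2.
  rewrite !mxE big_ord_recl big_ord1 !mxE -!expr2.
  by congr (_ + v _ _ ^+ 2); apply: val_inj.
move: isom; rewrite !sqE => isom.
have sqW i : (W *m d) i 0 ^+ 2 <= (2 * M) ^+ 2.
  by rewrite -real_normK ?num_real// ler_sqr ?nnegrE ?mulr_ge0// Wd.
(* Two squares of at most [4 M^2] each give [8 M^2 <= 9 M^2], hence the factor 3. *)
have bound : d ord0 0 ^+ 2 + d ord_max 0 ^+ 2 <= (3 * M) ^+ 2.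
  rewrite isom; apply: (le_trans (lerD (sqW _) (sqW _))).
  by have := sqr_ge0 M; rewrite !exprMn; lra.
have d1 : d ord0 0 = (n.1 - m.1)%:~R by rewrite !mxE /= intrB.
have d2 : d ord_max 0 = (n.2 - m.2)%:~R by rewrite !mxE /= intrB.
move: bound; rewrite d1 d2 => bound.
have M3 : 0 <= 3 * M by rewrite mulr_ge0.
split; rewrite -ler_sqr ?nnegrE// real_normK ?num_real// (le_trans _ bound)//.
  by rewrite lerDl sqr_ge0.
by rewrite lerDr sqr_ge0.
Qed.

(** Any point of the set can serve as the centre [c], since the others are within [3M <= L] of it in
    each coordinate. *)
Lemma rotated_box_enum (M : R) (L : nat) (S : set Z2) :
  rotated_boxes M S -> 3 * M <= L%:R ->
  exists (s : seq Z2) (c : Z2), enumerates s S /\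
    forall n, n \in s -> `|n.1 - c.1| <= L%:Z /\ `|n.2 - c.2| <= L%:Z.
Proof.
move=> hS ML.
have [[c Sc]|S0] := pselect (exists c, S c); last first.
  exists [::], (0, 0); split => //; split => // n.
  by split => // Sn; exfalso; apply: S0; exists n.
have near n : S n -> `|n.1 - c.1| <= L%:Z /\ `|n.2 - c.2| <= L%:Z.
  move=> Sn; have [h1 h2] := rotated_box_diam M S n c hS Sn Sc.
  split; rewrite -(ler_int R) intr_norm -pmulrn.
    exact: le_trans h1 ML.
  exact: le_trans h2 ML.
pose pts := [seq (c.1 + (i%:Z - L%:Z), c.2 + (j%:Z - L%:Z)) |
  i <- iota 0 (2 * L).+1, j <- iota 0 (2 * L).+1].
exists (undup [seq n <- pts | `[< S n >]]), c; split; last first.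
  by move=> n; rewrite mem_undup mem_filter => /andP[/asboolP /near].
split; first exact: undup_uniq.
move=> n; rewrite mem_undup mem_filter; split => [/andP[/asboolP]//|Sn].
apply/andP; split; first exact/asboolP.
have [h1 h2] := near n Sn.
apply/allpairsP; exists (absz (n.1 - c.1 + L%:Z), absz (n.2 - c.2 + L%:Z)).
rewrite !mem_iota /=; move: h1 h2; case: n {Sn} => n1 n2; case: c {Sc near pts} => c1 c2 /=.
by move=> h1 h2; split; [lia|lia|congr (_, _); lia].
Qed.

End Boxes.

(** * Suprema over time bins and the final exponents *)

Section MaximalFunction.
Context {R : realType}.

Lemma exists_half_sup (E : set R) : E !=set0 -> has_ubound E ->
  (forall e, E e -> 0 <= e) -> exists2 e, E e & sup E <= 2 * e.
Proof.
move=> E0 ubE Ege0; have hs : has_sup E by split.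
have [s0|s0] := leP (sup E) 0.
  have [e Ee] := E0; exists e => //; apply: (le_trans s0).
  by apply: mulr_ge0 => //; exact: Ege0.
have [e Ee se] := sup_adherent (divr_gt0 s0 (ltr0n R 2)) hs.
by exists e => //; lra.
Qed.

(* [b j] is the supremum over the [j]-th time bin and all of space; discretise by
   choosing a point where half of it is attained. *)
Lemma strichartz_sup (C p : R) : 1 < C -> 2 < p ->
  exists2 K : R, 0 < K &
  forall (L : nat) (s : seq Z2) (c : Z2) (a : Z2 -> R[i]) (a1 a2 : R),
  (0 < L)%N -> uniq s ->
  (forall n : Z2, n \in s -> `|n.1 - c.1| <= L%:Z /\ `|n.2 - c.2| <= L%:Z) ->
  C^-1 < a1 < C -> C^-1 < a2 < C ->
  exists b : nat -> R, [/\ forall j, 0 <= b j,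
    forall j t x, (j < L ^ 2)%N -> j%:R <= (L ^ 2)%:R * t <= j%:R + 1 ->
      cabs (\sum_(n <- s) a n * cis (phase a1 a2 n x t)) <= b j &
    \sum_(j < L ^ 2) b j `^ (2 * p)
      <= K * L%:R `^ (2 * p) * (\sum_(n <- s) cabs (a n) ^+ 2) `^ p].
Proof.
move=> C1 p2; have [K K0 HK] := discrete_strichartz C p C1 p2.
exists (2 `^ (2 * p) * K); first by rewrite mulr_gt0// powR_gt0.
move=> L s c a a1 a2 L0 us sc ha1 ha2.
pose F (x : R * R) (t : R) := cabs (\sum_(n <- s) a n * cis (phase a1 a2 n x t)).
have F0 x t : 0 <= F x t by exact: cabs_ge0.
have Fub x t : F x t <= \sum_(n <- s) cabs (a n).
  apply: (le_trans (cabs_sum _ _ _ _)); apply: ler_sum => n _.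
  by rewrite cabsM cabs_cis mulr1.
have L2 : (0 : R) < (L ^ 2)%:R by rewrite ltr0n expn_gt0 L0.
pose E (j : nat) : set R := [set y | exists (x : R * R) (t : R),
  j%:R <= (L ^ 2)%:R * t <= j%:R + 1 /\ y = F x t].
have E0 j : E j !=set0.
  exists (F (0, 0) (j%:R / (L ^ 2)%:R)), (0, 0), (j%:R / (L ^ 2)%:R).
  by split => //; rewrite mulrC divfK ?gt_eqF// lexx lerDl ler01.
have Eub j : has_ubound (E j).
  by exists (\sum_(n <- s) cabs (a n)) => y [x [t [_ ->]]].
have Ege0 j e : E j e -> 0 <= e by move=> [x [t [_ ->]]].
have pick j : exists q : (R * R) * R, j%:R <= (L ^ 2)%:R * q.2 <= j%:R + 1 /\
    sup (E j) <= 2 * F q.1 q.2.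
  have [e [x [t [jt ->]]] h] := exists_half_sup (E j) (E0 j) (Eub j) (Ege0 j).
  by exists (x, t).
have [q hq] := choice pick.
have b0 j : 0 <= sup (E j).
  have [e Ee] := E0 j.
  by apply: le_trans (ub_le_sup (Eub j) Ee); exact: Ege0 Ee.
exists (fun j => sup (E j)); split => // [j t x jL jt|].
  by apply: ub_le_sup => //; exists x, t.
have tb : forall j, (j < L ^ 2)%N -> j%:R <= L%:R ^+ 2 * (q j).2 <= j%:R + 1.
  by move=> j jL; rewrite -natrX; exact: (hq j).1.
have := HK L s c a a1 a2 (fun j => (q j).1) (fun j => (q j).2) L0 us sc ha1 ha2 tb.
move=> h; rewrite -!mulrA; rewrite -!mulrA in h.
apply: (le_trans _ (ler_wpM2l (powR_ge0 _ _) h)).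
rewrite mulr_sumr; apply: ler_sum => j _; rewrite -powRM//; last exact: F0.
have p0 : 0 <= 2 * p by lra.
apply: ge0_ler_powR; rewrite ?nnegrE//.
  by rewrite mulr_ge0// F0.
exact: (hq j).2.
Qed.

(** Discrete form of Hoelder in time: Cauchy-Schwarz over the bins combines the two [2p]-th power
    sums, while [A] bounds the first factor at all times. *)
Lemma sum_powR_product_le (p A Y B2 B3 : R) (J : nat) (b2 b3 : nat -> R) :
  0 <= A -> 0 <= Y -> 0 <= B2 -> 0 <= B3 ->
  (forall j, 0 <= b2 j) -> (forall j, 0 <= b3 j) ->
  \sum_(j < J) b2 j `^ (2 * p) <= Y * B2 `^ p ->
  \sum_(j < J) b3 j `^ (2 * p) <= Y * B3 `^ p ->
  \sum_(j < J) (A * (b2 j * b3 j)) `^ p <=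
    Y * (A * Num.sqrt B2 * Num.sqrt B3) `^ p.
Proof.
move=> A0 Y0 B20 B30 b20 b30 sb2 sb3.
have sqp (z : R) : 0 <= z -> z `^ (2 * p) = (z `^ p) ^+ 2.
  by move=> z0; rewrite mulrC powRrM powR_mulrn ?powR_ge0.
have Bp (B : R) : 0 <= B -> B `^ p = (Num.sqrt B `^ p) ^+ 2.
  move=> B0; rewrite -sqp ?sqrtr_ge0// powRrM powR_mulrn ?sqrtr_ge0//.
  by rewrite sqr_sqrtr.
rewrite (eq_bigr (fun j : 'I_J => A `^ p * (b2 j `^ p * b3 j `^ p)));
  last by move=> j _; rewrite !powRM ?mulr_ge0.
rewrite -mulr_sumr !powRM ?mulr_ge0 ?sqrtr_ge0//.
rewrite -(mulrA (A `^ p)) [leRHS]mulrCA ler_wpM2l ?powR_ge0//.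
rewrite -ler_sqr ?nnegrE; last 2 first.
- by apply: sumr_ge0 => j _; rewrite mulr_ge0 ?powR_ge0.
- by rewrite !mulr_ge0 ?powR_ge0.
apply: (le_trans (sum_Cauchy_Schwarz _ _ _ _)).
have -> : (Y * (Num.sqrt B2 `^ p * Num.sqrt B3 `^ p)) ^+ 2 =
    (Y * B2 `^ p) * (Y * B3 `^ p).
  by rewrite (Bp B2)// (Bp B3)//; ring.
apply: ler_pM.
- by apply: sumr_ge0 => j _; exact: sqr_ge0.
- by apply: sumr_ge0 => j _; exact: sqr_ge0.
- by apply: le_trans sb2; apply: ler_sum => j _; rewrite sqp.
- by apply: le_trans sb3; apply: ler_sum => j _; rewrite sqp.
Qed.

(** The bin length [L^(-2)] reduces [L^(2p)] to [L^(2p-2)], whose [p]-th root is [L^(2-2/p)]; then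
    [L <= 4M] is used. *)
Lemma powR_root_le (K M A p : R) (L : nat) : 1 <= p -> 0 <= K -> 0 <= A ->
  0 <= M -> (0 < L)%N -> L%:R <= 4 * M ->
  (K * L%:R `^ (2 * p) / (L ^ 2)%:R * A `^ p) `^ p^-1 <=
    K `^ p^-1 * 4 `^ (2 - 2 / p) * M `^ (2 - 2 / p) * A.
Proof.
move=> p1 K0 A0 M0 L0 LM; have p0 : 0 < p by lra.
have L0' : (0 : R) < L%:R by rewrite ltr0n.
have -> : K * L%:R `^ (2 * p) / (L ^ 2)%:R = K * L%:R `^ (2 * p - 2).
  rewrite -mulrA powRB; last by rewrite (gt_eqF L0') implybT.
  by rewrite (powR_mulrn 2) ?(ltW L0')// natrX.
rewrite !powRM ?powR_ge0 ?mulr_ge0 ?powR_ge0//.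
rewrite -!powRrM mulfV ?gt_eqF// powRr1//.
rewrite ler_wpM2r// -mulrA ler_wpM2l ?powR_ge0//.
rewrite -powRM//; have -> : (2 * p - 2) / p = 2 - 2 / p by field; rewrite gt_eqF.
apply: ge0_ler_powR; rewrite ?nnegrE//; last exact: mulr_ge0.
by rewrite subr_ge0 ler_pdivrMr//; lra.
Qed.

End MaximalFunction.

Theorem lemma3p4 (R : realType) (C : R) (hC : 1 < C)
  (tau0 : interval R) (htau0 : [set` tau0] `<=` `[0, 1])
  (p : R) (hp : 2 < p <= 4) :
  exists c : R, 0 < c /\
    forall a1 a2 : R, C^-1 < a1 < C -> C^-1 < a2 < C ->
    forall N M : R, 1 <= N -> 1 <= M -> M <= N ->
    forall C1 C2 C3 : set Z2,
      rotated_boxes N C1 -> rotated_boxes M C2 -> rotated_boxes M C3 ->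
    forall phi1 phi2 phi3 : R * R -> R[i], L2 phi1 -> L2 phi2 -> L2 phi3 ->
      (LpL2norm p [set` tau0]
         (fun t x => (fourier_proj C1 (schrodinger a1 a2 t phi1) x
                   * fourier_proj C2 (schrodinger a1 a2 t phi2) x
                   * fourier_proj C3 (schrodinger a1 a2 t phi3) x)%R)
       <= (c * M `^ (2 - 2 / p))%:E
          * (L2norm (fourier_proj C1 phi1)
             * L2norm (fourier_proj C2 phi2)
             * L2norm (fourier_proj C3 phi3)))%E.
Proof.
have /andP[p2 _] := hp; have p0 : 0 < p by lra.
have p1 : 1 <= p by lra.
have [K K0 HK] := strichartz_sup C p hC p2.
exists (K `^ p^-1 * 4 `^ (2 - 2 / p)); split.
  by rewrite mulr_gt0 ?powR_gt0.
move=> a1 a2 ha1 ha2 N M N1 M1 _ C1 C2 C3 hC1 hC2 hC3 f1 f2 f3 _ _ _.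
have ceil_le (X : R) : 1 <= X ->
    exists2 L : nat, (0 < L)%N & 3 * X <= L%:R <= 4 * X.
  move=> X1; exists (Num.truncn (3 * X)).+1 => //.
  have X3 : 0 <= 3 * X by lra.
  have /andP[h1 h2] := truncn_itv X3.
  by rewrite (ltW h2) -natr1; lra.
(* [LN] serves only to enumerate [C1]; it enters no estimate, so the constant is independent of
   [N]. *)
have [LN LN0 /andP[NL _]] := ceil_le N N1.
have [L L0 /andP[ML LM]] := ceil_le M M1.
have [s1 [c1 [e1 _]]] := rotated_box_enum N LN C1 hC1 NL.
have [s2 [c2 [e2 n2]]] := rotated_box_enum M L C2 hC2 ML.
have [s3 [c3 [e3 n3]]] := rotated_box_enum M L C3 hC3 ML.
pose B1 := \sum_(n <- s1) cabs (fourier f1 n) ^+ 2.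
pose B2 := \sum_(n <- s2) cabs (fourier f2 n) ^+ 2.
pose B3 := \sum_(n <- s3) cabs (fourier f3 n) ^+ 2.
pose A1 := Num.sqrt B1; pose A2 := Num.sqrt B2; pose A3 := Num.sqrt B3.
set c := K `^ p^-1 * 4 `^ (2 - 2 / p) * M `^ (2 - 2 / p).
apply: (@le_trans _ _ (c%:E * (A1%:E * A2%:E * A3%:E))%E); last first.
  rewrite le_eqVlt; apply/orP; left; apply/eqP; congr (_ * (_ * _ * _))%E.
  - exact/esym/(L2norm_fourier_proj C1 s1 f1 e1).
  - exact/esym/(L2norm_fourier_proj C2 s2 f2 e2).
  - exact/esym/(L2norm_fourier_proj C3 s3 f3 e3).
have B20 : 0 <= B2 by apply: sumr_ge0 => n _; exact: sqr_ge0.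
have B30 : 0 <= B3 by apply: sumr_ge0 => n _; exact: sqr_ge0.
have [b2 [b20 hb2 sb2]] := HK L s2 c2 (fourier f2) a1 a2 L0 e2.1 n2 ha1 ha2.
have [b3 [b30 hb3 sb3]] := HK L s3 c3 (fourier f3) a1 a2 L0 e3.1 n3 ha1 ha2.
have J0 : (0 < L ^ 2)%N by rewrite expn_gt0 L0.
have A1_ge0 : 0 <= A1 by exact: sqrtr_ge0.
have A2_ge0 : 0 <= A2 by exact: sqrtr_ge0.
have A3_ge0 : 0 <= A3 by exact: sqrtr_ge0.
pose u (t : R) (x : R * R) := fourier_proj C1 (schrodinger a1 a2 t f1) x
  * fourier_proj C2 (schrodinger a1 a2 t f2) x
  * fourier_proj C3 (schrodinger a1 a2 t f3) x.
(* On bin [j] the first factor has [L^2] norm at most [A1], and the other two are bounded by their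
   suprema [b2 j] and [b3 j]. *)
have int_le : (\int[@lebesgue_measure R]_(t in [set` tau0]) (L2norm (u t) `^ p)
   <= ((\sum_(j < L ^ 2) (A1 * (b2 j * b3 j)) `^ p) / (L ^ 2)%:R)%:E)%E.
  apply: (integral_le_bins _ _ _ (fun j => (A1 * (b2 j * b3 j)) `^ p)) => //.
  - by move=> t; exact: poweR_ge0.
  - by move=> j; exact: powR_ge0.
  move=> j t jL jt; rewrite -poweR_EFin; apply: gt0_ler_poweR.
  - exact: ltW.
  - by rewrite in_itv /= leey andbT L2normE poweR_ge0.
  - by rewrite in_itv /= leey andbT lee_fin !mulr_ge0.
  apply: (L2norm_product_le a1 a2 t C1 C2 C3 s1 s2 s3) => // x.
    exact: hb2.
  exact: hb3.
pose Y := K * L%:R `^ (2 * p).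
have Y0 : 0 <= Y by rewrite mulr_ge0 ?powR_ge0// ltW.
have sum_le : \sum_(j < L ^ 2) (A1 * (b2 j * b3 j)) `^ p <=
    Y * (A1 * A2 * A3) `^ p.
  exact: (sum_powR_product_le p A1 Y B2 B3 (L ^ 2) b2 b3 A1_ge0 Y0 B20 B30
    b20 b30 sb2 sb3).
have total : (\int[@lebesgue_measure R]_(t in [set` tau0]) (L2norm (u t) `^ p)
    <= (Y / (L ^ 2)%:R * (A1 * A2 * A3) `^ p)%:E)%E.
  apply: (le_trans int_le); rewrite lee_fin mulrAC ler_wpM2r ?invr_ge0//.
have AAA : 0 <= A1 * A2 * A3 by rewrite !mulr_ge0.
rewrite /LpL2norm.
apply: (@le_trans _ _ ((Y / (L ^ 2)%:R * (A1 * A2 * A3) `^ p)%:E `^ p^-1)%E).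
  apply: gt0_ler_poweR => //.
  - by rewrite invr_ge0 ltW.
  - rewrite in_itv /= leey andbT; apply: integral_ge0 => t _.
    exact: poweR_ge0.
  - rewrite in_itv /= leey andbT lee_fin.
    by apply: mulr_ge0; [apply: divr_ge0|exact: powR_ge0].
rewrite poweR_EFin -!EFinM lee_fin.
exact: (powR_root_le K M (A1 * A2 * A3) p L p1 (ltW K0) AAA (le_trans ler01 M1) L0 LM).
Qed.
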